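(* Let $X$ be an irreducible variety and let $G$ be a subgroup of $\mathrm{Aut}(X)$ generated by a collection $\mathcal I$ of unital algebraic families in $\mathrm{Aut}(X)$. Let $Y$ be a $G$-invariant locally closed subvariety of $X$. Then there is a family $\{\varphi_t\}_{t\in T}$ derived from $\mathcal I$ and exhaustive for the natural action of $G$ on $Y$, i.e., such that $G(y)=\{\varphi_t(y)\mid t\in T\}$ for every point $y\in Y$.
   Context: Varieties are algebraic varieties in the sense of Serre over an algebraically closed field $k$ of arbitrary characteristic; $\mathrm{Aut}(X)$ is the group of automorphisms of the variety $X$. A family $\{\varphi_t\}_{t\in T}$ in $\mathrm{Aut}(X)$ parameterized by an irreducible variety $T$ is a map $\varphi\colon T\to \mathrm{Aut}(X)$, $t\mapsto\varphi_t$; put $\varphi_T:=\{\varphi_t\mid t\in T\}$. The family is unital if $\mathrm{id}_X\in\varphi_T$, and algebraic if the map $T\times X\to X$, $(t,x)\mapsto \varphi_t(x)$, is a morphism. The inverse of $\{\varphi_t\}_{t\in T}$ is the family $\{\varphi_t^{-1}\}_{t\in T}$. The product of a finite sequence of families $\{\varphi_t\}_{t\in T},\dots,\{\psi_s\}_{s\in S}$ is the family $\{\varphi_t\circ\cdots\circ\psi_s\}_{(t,\dots,s)\in T\times\cdots\times S}$. Given a nonempty collection $\mathcal I$ of families in $\mathrm{Aut}(X)$, the group generated by $\mathcal I$ is the subgroup of $\mathrm{Aut}(X)$ generated, as an abstract group, by the union of the sets $\varphi_T$ over all families $\{\varphi_t\}_{t\in T}$ in $\mathcal I$. A family is derived from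 $\mathcal I$ if it is a product of (finitely many) families each of which is either a family from $\mathcal I$ or the inverse of such a family. For $x\in X$, $G(x):=\{g(x)\mid g\in G\}$. *)

(* Defs.v *)
From HB Require Import structures.
From mathcomp Require Import all_boot all_order all_algebra.
From mathcomp Require Import finmap all_classical topology.
From mathcomp Require Import -(notations) mpoly.

Set Implicit Arguments.
Unset Strict Implicit.
Unset Printing Implicit Defensive.

Import GRing.Theory.
Local Open Scope classical_set_scope.
Local Open Scope ring_scope.

(* A topological space X with a subsheaf O_X of the sheaf of germs of k-valued
   functions: [regular x f] says that the germ of f at x belongs to O_X.  The
   first axiom says that this depends only on the germ of f, the second one
   that O_X is open in the (etale) space of germs of functions. *)
Record fspace (k : fieldType) := FSpace {
  fspace_top :> topologicalType;
  regular : fspace_top -> (fspace_top -> k) -> Prop;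
  regular_local : forall x f g,
    (\forall y \near x, f y = g y) -> regular x f -> regular x g;
  regular_open : forall x f,
    regular x f -> \forall y \near x, regular y f }.

Definition regular_on (k : fieldType) (X : fspace k) (U : set X)
    (f : X -> k) : Prop :=
  forall x, U x -> regular x f.

Definition regular_map (k : fieldType) (X Y : fspace k) (f : X -> Y) : Prop :=
  continuous f /\
  forall (x : X) (h : Y -> k), regular (f x) h -> regular x (h \o f).

Definition isomorphic (k : fieldType) (X Y : fspace k) : Prop :=
  exists (f : X -> Y) (g : Y -> X),
    [/\ cancel f g, cancel g f, regular_map f & regular_map g].

Section Induced.
Context {k : fieldType} (X : fspace k) (Z : set X).

Definition induced_regular (z : Z) (f : Z -> k) : Prop :=
  exists2 g : X -> k,
    regular (set_val z) g & \forall w \near z, f w = g (set_val w).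

Fact induced_regular_local (z : Z) (f g : Z -> k) :
  (\forall w \near z, f w = g w) ->
  induced_regular z f -> induced_regular z g.
Proof.
move=> fg [h rh fh]; exists h => //.
by apply: filterS2 fg fh => w <-.
Qed.

Fact induced_regular_open (z : Z) (f : Z -> k) :
  induced_regular z f -> \forall w \near z, induced_regular w f.
Proof.
move=> [h rh /nbhs_interior fh].
have := @initial_continuous Z X set_val z _ (regular_open rh).
rewrite nbhs_simpl /= => rhz.
by apply: filterS2 rhz fh => w hw fw; exists h.
Qed.

Definition induced_space : fspace k :=
  FSpace induced_regular_local induced_regular_open.

End Induced.

Definition locally_closed (T : topologicalType) (Z : set T) : Prop :=
  exists U C : set T, [/\ open U, closed C & Z = U `&` C].

Definition affine_carrier (k : fieldType) (n : nat) : Type := 'rV[k]_n.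

HB.instance Definition _ (k : fieldType) (n : nat) := Choice.on (affine_carrier k n).

Section AffineSpace.
Context (k : fieldType) (n : nat).

Definition peval (p : mpoly n k) (x : affine_carrier k n) : k :=
  meval (fun i => (x : 'rV[k]_n) ord0 i) p.

Definition zero_locus (S : set (mpoly n k)) : set (affine_carrier k n) :=
  [set x | forall p, S p -> peval p x = 0].

Definition zariski_open (U : set (affine_carrier k n)) : Prop :=
  exists S : set (mpoly n k), ~` U = zero_locus S.

Fact zariski_openT : zariski_open setT.
Proof.
exists [set 1]; rewrite setCT; apply/seteqP; split=> x //= /(_ _ erefl).
by rewrite /peval meval1 => /eqP; rewrite oner_eq0.
Qed.

Fact zariski_openI : setI_closed zariski_open.
Proof.
move=> U V [S US] [S' VS']; rewrite /zariski_open.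
exists [set r | exists p q, [/\ S p, S' q & r = p * q]].
rewrite setCI US VS'; apply/seteqP; split=> x.
  by case=> hx _ [p [q [Sp Sq ->]]]; rewrite /peval mevalM;
     [rewrite [X in X * _]hx ?mul0r|rewrite [X in _ * X]hx ?mulr0].
move=> hx; have [|/existsNP[p /not_implyP[Sp px]]] := pselect (zero_locus S x);
  first by left.
right=> q Sq; have := hx (p * q) (ex_intro _ p (ex_intro _ q (And3 Sp Sq erefl))).
by rewrite /peval mevalM => /eqP; rewrite mulf_eq0 => /orP[/eqP|/eqP].
Qed.

Fact zariski_open_bigU (I : Type) (f : I -> set (affine_carrier k n)) :
  (forall i, zariski_open (f i)) -> zariski_open (\bigcup_i f i).
Proof.
move=> fo; have {fo}[S fS] := choice fo.
exists (\bigcup_i S i); rewrite setC_bigcup; apply/seteqP; split=> x hx.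
  by move=> p [i _ Sp]; have := hx i Logic.I; rewrite fS; exact.
by move=> i _; rewrite fS => p Sp; apply: hx; exists i.
Qed.

HB.instance Definition _ := isOpenTopological.Build (affine_carrier k n)
  zariski_openT zariski_openI zariski_open_bigU.

Definition affine_regular (x : affine_carrier k n) (f : affine_carrier k n -> k) : Prop :=
  exists p q : mpoly n k,
    peval q x != 0 /\ \forall y \near x, f y = peval p y / peval q y.

Fact affine_regular_local (x : affine_carrier k n) (f g : affine_carrier k n -> k) :
  (\forall y \near x, f y = g y) -> affine_regular x f -> affine_regular x g.
Proof.
move=> fg [p [q [qx fpq]]]; exists p, q; split=> //.
by apply: filterS2 fg fpq => w <-.
Qed.

Fact affine_regular_open (x : affine_carrier k n) (f : affine_carrier k n -> k) :
  affine_regular x f -> \forall y \near x, affine_regular y f.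
Proof.
move=> [p [q [qx /nbhs_interior fpq]]].
have qn0 : \forall y \near x, peval q y != 0.
  apply: (@open_nbhs_nbhs _ x [set y | peval q y != 0]); split=> //.
  exists [set q]; apply/seteqP; split=> y /=.
    by move=> /negP; rewrite negbK => /eqP qy _ ->.
  by move=> /(_ q erefl) ->; rewrite eqxx.
by apply: filterS2 qn0 fpq => y qy fy; exists p, q.
Qed.

Definition affine_space : fspace k :=
  FSpace affine_regular_local affine_regular_open.

End AffineSpace.

(* The product is equipped with the structure which on varieties is that of the
   product variety: its functions are locally quotients of functions
   sum_i a_i(x) b_i(y), with a_i and b_i regular, and its topology is generated
   by the nonvanishing loci of such functions (it is finer than the product
   topology, whence the alias [prod_carrier] of the product type). *)
Definition prod_carrier (k : fieldType) (X Y : fspace k) : Type := (X * Y)%type.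

HB.instance Definition _ (k : fieldType) (X Y : fspace k) :=
  Choice.copy (prod_carrier X Y) (X * Y)%type.

Section Product.
Context (k : fieldType) (X Y : fspace k).

Definition tensor_on (U : set X) (V : set Y) (h : prod_carrier X Y -> k) :
    Prop :=
  exists (n : nat) (a : 'I_n -> X -> k) (b : 'I_n -> Y -> k),
    [/\ forall i, regular_on U (a i),
        forall i, regular_on V (b i) &
        forall z, h z = \sum_i a i z.1 * b i z.2].

Definition prod_basic : set (set (prod_carrier X Y)) :=
  [set W | exists (U : set X) (V : set Y) (h : prod_carrier X Y -> k),
    [/\ open U, open V, tensor_on U V h &
        W = (U `*` V) `&` [set z | h z != 0]]].

HB.instance Definition _ :=
  isSubBaseTopological.Build (prod_carrier X Y) prod_basic id.

Definition prod_regular (z : prod_carrier X Y) (f : prod_carrier X Y -> k) :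
    Prop :=
  exists (U : set X) (V : set Y) (g h : prod_carrier X Y -> k),
    [/\ [/\ open U, open V & (U `*` V) z],
        tensor_on U V g, tensor_on U V h, h z != 0 &
        \forall w \near z, f w = g w / h w].

Fact prod_basic_open (W : set (prod_carrier X Y)) : prod_basic W -> open W.
Proof.
move=> bW; rewrite openE => z Wz; exists W; split=> //.
exists [set W]; last by rewrite bigcup_set1.
move=> _ ->; exists [fset W]%fset.
  by move=> A /fset1P ->; exact: mem_set.
apply/seteqP; split=> w /=; first by move=> /(_ W); apply; rewrite /= inE.
by move=> Ww A /=; rewrite inE => /eqP ->.
Qed.

Fact prod_regular_local (z : prod_carrier X Y) (f g : prod_carrier X Y -> k) :
  (\forall w \near z, f w = g w) -> prod_regular z f -> prod_regular z g.
Proof.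
move=> fg [U [V [a [b [oUV ta tb bz fab]]]]]; exists U, V, a, b; split=> //.
by apply: filterS2 fg fab => w <-.
Qed.

Fact prod_regular_open (z : prod_carrier X Y) (f : prod_carrier X Y -> k) :
  prod_regular z f -> \forall w \near z, prod_regular w f.
Proof.
move=> [U [V [a [b [[oU oV UVz] ta tb bz /nbhs_interior fab]]]]].
have Wz : nbhs z ((U `*` V) `&` [set z | b z != 0]).
  apply: open_nbhs_nbhs; split; last by [].
  by apply: prod_basic_open; exists U, V, b.
by apply: filterS2 Wz fab => w [UVw bw] fw; exists U, V, a, b.
Qed.

Definition prod_space : fspace k :=
  FSpace prod_regular_local prod_regular_open.

End Product.

(* Varieties are those of Serre's FAC: a finite open covering by locally closed
   subspaces of affine spaces, and a closed diagonal.  They need be neither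
   irreducible nor nonempty. *)
Definition prevariety (k : fieldType) (X : fspace k) : Prop :=
  exists (m : nat) (V : 'I_m -> set X),
    [/\ forall i, open (V i),
        \bigcup_i V i = setT &
        forall i, exists (n : nat) (Z : set (affine_space k n)),
          locally_closed Z /\
          isomorphic (induced_space (V i)) (induced_space Z)].

Definition variety (k : fieldType) (X : fspace k) : Prop :=
  prevariety X /\ closed [set z : prod_space X X | z.1 = z.2].

Definition irreducible (T : topologicalType) : Prop :=
  [set: T] !=set0 /\
  forall A B : set T, closed A -> closed B -> A `|` B = setT ->
    A = setT \/ B = setT.

Definition irreducible_variety (k : fieldType) (X : fspace k) : Prop :=
  variety X /\ irreducible X.

Section Automorphisms.
Context (k : fieldType) (X : fspace k).

Record aut := Aut {
  aut_fun :> X -> X;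
  aut_inv : X -> X;
  aut_funK : cancel aut_fun aut_inv;
  aut_invK : cancel aut_inv aut_fun;
  aut_fun_regular : regular_map aut_fun;
  aut_inv_regular : regular_map aut_inv }.

Fact aut_eqP (g h : aut) : (forall x, g x = h x) -> g = h.
Proof.
case: g => g g' gK g'K mg mg'; case: h => h h' hK h'K mh mh' /= /funext gh.
subst h; have gh' : g' = h' by apply/funext => x; rewrite -[x in LHS]h'K gK.
by subst h'; congr Aut; exact: Prop_irrelevance.
Qed.

Fact regular_map_id : regular_map (@id X).
Proof. by split=> [x //|x h]. Qed.

Fact regular_map_comp (f g : X -> X) :
  regular_map f -> regular_map g -> regular_map (f \o g).
Proof.
move=> [cf rf] [cg rg]; split=> [x|x h /rf /rg //].
exact: (continuous_comp (cg x) (cf (g x))).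
Qed.

Definition aut_id : aut :=
  @Aut id id (fun=> erefl) (fun=> erefl) regular_map_id regular_map_id.

Definition aut_comp (g h : aut) : aut :=
  Aut (can_comp (aut_funK g) (aut_funK h))
      (can_comp (aut_invK h) (aut_invK g))
      (regular_map_comp (aut_fun_regular g) (aut_fun_regular h))
      (regular_map_comp (aut_inv_regular h) (aut_inv_regular g)).

Definition aut_symm (g : aut) : aut :=
  Aut (aut_invK g) (aut_funK g) (aut_inv_regular g) (aut_fun_regular g).

HB.instance Definition _ := gen_eqMixin aut.
HB.instance Definition _ := gen_choiceMixin aut.

Fact aut_compA : associative aut_comp.
Proof. by move=> f g h; apply: aut_eqP. Qed.
Fact aut_comp1g : left_id aut_id aut_comp.
Proof. by move=> g; apply: aut_eqP. Qed.
Fact aut_compg1 : right_id aut_id aut_comp.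
Proof. by move=> g; apply: aut_eqP. Qed.
Fact aut_compVg : left_inverse aut_id aut_symm aut_comp.
Proof. by move=> g; apply: aut_eqP => x; exact: aut_funK. Qed.
Fact aut_compgV : right_inverse aut_id aut_symm aut_comp.
Proof. by move=> g; apply: aut_eqP => x; exact: aut_invK. Qed.

HB.instance Definition _ := isGroup.Build aut
  aut_compA aut_comp1g aut_compg1 aut_compVg aut_compgV.

End Automorphisms.

Section Families.
Context (k : fieldType) (X : fspace k).

Record aut_family := AutFamily {
  param : fspace k;
  param_irreducible : irreducible_variety param;
  fam :> param -> aut X }.

Definition unital (F : aut_family) : Prop := range F 1%g.

Definition algebraic (F : aut_family) : Prop :=
  @regular_map k (prod_space (param F) X) X (fun z => F z.1 z.2).

Definition inverse_family (F : aut_family) : aut_family :=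
  AutFamily (param_irreducible F) (fun t => (F t)^-1)%g.

(* A family is parameterized by an irreducible variety, hence the argument [irr];
   over an algebraically closed field it always holds. *)
Definition product_family (F H : aut_family)
    (irr : irreducible_variety (prod_space (param F) (param H))) : aut_family :=
  AutFamily irr (fun z => F z.1 * H z.2)%g.

Definition generated_group (I : aut_family -> Prop) : set (aut X) :=
  smallest (fun H : set (aut X) => group_closed [in H])
    [set g | exists F : aut_family, I F /\ range F g].

Inductive family_or_inverse (I : aut_family -> Prop) : aut_family -> Prop :=
| FamilyOf F : I F -> family_or_inverse I F
| InverseOf F : I F -> family_or_inverse I (inverse_family F).

(* A product of n >= 1 families is associated as F_1 * (F_2 * (... * F_n)). *)
Inductive derived (I : aut_family -> Prop) : aut_family -> Prop :=
| DerivedOne F : family_or_inverse I F -> derived I F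
| DerivedCons F H
    (irr : irreducible_variety (prod_space (param F) (param H))) :
    family_or_inverse I F -> derived I H -> derived I (product_family irr).

Definition aut_orbit (G : set (aut X)) (x : X) : set X := [set g x | g in G].

Definition aut_invariant (G : set (aut X)) (Y : set X) : Prop :=
  forall g, G g -> [set g y | y in Y] `<=` Y.

Definition exhaustive (F : aut_family) (G : set (aut X)) (Y : set X) : Prop :=
  forall y, Y y -> aut_orbit G y = [set F t y | t in [set: param F]].

End Families.

(* Main.v *)
(* The orbit of x under G is the union of the images of x under products of
   families of I and inverses.  To avoid proving that the inverse of an algebraic
   family is algebraic, geometry is applied only to products F of families of I
   without inverses.  Each
   such F has a graph {(x, F_t x)}, which over a closed irreducible G-invariant C
   is the image of the irreducible T * C, so its closure is irreducible; since
   dimensions are bounded, one F has the greatest closure Z.  Z is stable under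
   the action of G on the second factor: for f in a family of I, f Z is contained
   in Z, hence equal to Z, as closed sets satisfy the descending chain condition.
   So Z contains (x, g x) for all g in G.  By Chevalley's theorem the graph of F
   contains a nonempty open subset U of Z.  If U meets both slices over x and
   g x, then some F_t x = F_s (g x), i.e., F^-1 F carries x to g x.  This applies
   to all x in a nonempty open subset V of C; finitely many translates of V cover
   an open G-invariant subset of C, and noetherian induction finishes.
   An exhaustive family for X is exhaustive for every invariant Y. *)
Require Import Defs.
From mathcomp Require Import all_boot all_order all_algebra.
From mathcomp Require Import finmap all_classical topology.
From mathcomp Require Import -(notations) mpoly.
From mathcomp Require Import closed_field.

Set Implicit Arguments.
Unset Strict Implicit.
Unset Printing Implicit Defensive.

Import Order.TTheory GRing.Theory.
Local Open Scope classical_set_scope.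
Local Open Scope ring_scope.

(** * Irreducible sets and chain conditions *)

Section IrreducibleSets.
Implicit Types T S : topologicalType.

(** A maximal closure of graphs is the greatest because the families are unital: the graph of a
    product contains those of both factors. Bounded dimension is used only in the form that
    irreducible closed sets admit no infinite strictly increasing sequence. The slices of [U] over
    [x] and over [g x] have no evident common point. One is found because products of families
    without inverses already reach a dense part of the orbit of [x], and any two of their elements
    lie in a single such product [H]: the parameters [r] sending [x] into either slice form nonempty
    open subsets of an irreducible space, hence intersect. Then [H r x] lies in the graph over both
    [x] and [g x]. The noetherian induction must reduce to an irreducible set, while closed pieces
    of an invariant set need not be invariant. If two closed sets cover it, the points whose whole
    orbit stays in one of them form an invariant closed subset; as orbits are irreducible, the two
    subsets obtained in this way still cover. *)

Definition irreducible_set T (A : set T) : Prop :=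
  A !=set0 /\ forall P Q : set T, closed P -> closed Q ->
    A `<=` P `|` Q -> A `<=` P \/ A `<=` Q.

Lemma irreducible_setT T : irreducible T -> irreducible_set [set: T].
Proof.
move=> [T0 irr]; split=> // P Q cP cQ TPQ.
by case: (irr P Q cP cQ) => [|->|->]; [apply/seteqP; split|left|right].
Qed.

Lemma irreducible_setI2 T (A U V : set T) : irreducible_set A ->
  open U -> open V -> A `&` U !=set0 -> A `&` V !=set0 ->
  A `&` (U `&` V) !=set0.
Proof.
move=> [_ irr] oU oV [x [Ax Ux]] [y [Ay Vy]]; apply: contrapT => AUV.
have [] := irr (~` U) (~` V); rewrite ?closedC// ?openC//.
- move=> z Az; apply: contrapT => /not_orP[/contrapT Uz /contrapT Vz].
  by apply: AUV; exists z.
- by move=> /(_ x Ax).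
- by move=> /(_ y Ay).
Qed.

Lemma irreducible_set_closure T (A : set T) :
  irreducible_set A -> irreducible_set (closure A).
Proof.
move=> [[x Ax] irr]; split; first by exists x; exact: subset_closure.
move=> P Q cP cQ APQ; have [|/closureS AP|/closureS AQ] := irr P Q cP cQ.
- by apply: subset_trans APQ; exact: subset_closure.
- by left; apply: subset_trans AP _.
- by right; apply: subset_trans AQ _.
Qed.

Lemma irreducible_setI_dense T (A U : set T) : irreducible_set A ->
  open U -> A `&` U !=set0 -> A `<=` closure (A `&` U).
Proof.
move=> irrA oU AU x Ax B; rewrite nbhsE => -[V [oV Vx] VB].
have [|y [Ay [Uy Vy]]] := irreducible_setI2 irrA oU oV AU; first by exists x.
by exists y; split=> //; exact: VB.
Qed.

Lemma irreducible_setI T (A U : set T) : irreducible_set A ->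
  open U -> A `&` U !=set0 -> irreducible_set (A `&` U).
Proof.
move=> irrA oU AU; split=> // P Q cP cQ APQ.
have /closureS := APQ; rewrite -(proj1 (closure_id _) (closedU cP cQ)).
move/(subset_trans (irreducible_setI_dense irrA oU AU)) => {}APQ.
by have [AP|AQ] := proj2 irrA P Q cP cQ APQ; [left=> x [/AP]|right=> x [/AQ]].
Qed.

(** Continuity of the restriction to [A] in the subspace topology, for a total function whose values
    off [A] are arbitrary. Charts and their inverses are handled in this form, without subtypes. *)
Definition continuous_on T S (A : set T) (f : T -> S) : Prop :=
  forall x, A x -> forall V, open V -> V (f x) ->
    \forall y \near x, A y -> V (f y).

Lemma continuous_onT T S (f : T -> S) : continuous_on setT f <-> continuous f.
Proof.
split=> cf x.
  move=> B; rewrite nbhsE => -[V [oV Vfx] VB].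
  by apply: filterS (cf x Logic.I V oV Vfx) => y /(_ Logic.I) /VB.
move=> _ V oV Vfx; have Vx : \forall y \near x, V (f y) := cf x V (open_nbhs_nbhs (conj oV Vfx)).
by apply: filterS Vx => y Vy _.
Qed.

Lemma continuous_onS T S (A B : set T) (f : T -> S) :
  A `<=` B -> continuous_on B f -> continuous_on A f.
Proof.
by move=> AB cf x /AB Bx V oV Vfx; apply: filterS (cf x Bx V oV Vfx) => y h /AB.
Qed.

Lemma continuous_on_closed T S (A : set T) (f : T -> S) (D : set S) :
  continuous_on A f -> closed D ->
  forall x, A x -> closure (A `&` f @^-1` D) x -> D (f x).
Proof.
move=> cf cD x Ax clx; apply: contrapT => nD.
have oD : open (~` D) by rewrite openC.
have [y [[Ay Dy]]] := clx _ (cf x Ax _ oD nD).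
by move/(_ Ay).
Qed.

Lemma continuous_on_image T S (A B : set T) (f : T -> S) :
  continuous_on A f -> B `<=` A ->
  forall x, A x -> closure B x -> closure (f @` B) (f x).
Proof.
move=> cf BA x Ax clx.
apply: (continuous_on_closed cf _ Ax); first exact: closed_closure.
apply: closureS clx => y By; split; first exact: BA.
by apply: subset_closure; exists y.
Qed.

Lemma irreducible_set_image T S (A : set T) (f : T -> S) :
  continuous_on A f -> irreducible_set A -> irreducible_set (f @` A).
Proof.
move=> cf [[x Ax] irr]; split; first by exists (f x), x.
move=> P Q cP cQ fPQ.
(* The preimages of [P] and [Q] in [A] need not be closed in [T]; by continuity on [A] their
   closures contain no further point of [A]. *)
have [||y Ay|AP|AQ] := irr (closure (A `&` f @^-1` P)) (closure (A `&` f @^-1` Q)).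
- exact: closed_closure.
- exact: closed_closure.
- have [Py|Qy] := fPQ (f y) (imageP _ Ay); [left|right];
  by apply: subset_closure; split.
- by left=> _ [y Ay <-]; exact: (continuous_on_closed cf cP Ay (AP y Ay)).
- by right=> _ [y Ay <-]; exact: (continuous_on_closed cf cQ Ay (AQ y Ay)).
Qed.

End IrreducibleSets.

Section ChainConditions.
Implicit Types T S : topologicalType.

(** The chain consists of closed sets of the whole space and only the conclusion is restricted to
    [V], so that one chain can be tested on each member of a cover. *)
Definition noetherian_on T (V : set T) : Prop :=
  forall C : nat -> set T, (forall i, closed (C i)) ->
    (forall i, C i.+1 `<=` C i) ->
    exists N, forall i, (N <= i)%N -> V `&` C N `<=` C i.

Lemma chain_homo (T : Type) (C : nat -> set T) :
  (forall i, C i.+1 `<=` C i) -> forall i j, (i <= j)%N -> C j `<=` C i.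
Proof.
move=> dC i j /subnKC <-; elim: (j - i)%N => [|m IH]; first by rewrite addn0.
by rewrite addnS; apply: subset_trans IH.
Qed.

Lemma noetherian_cover T m (V : 'I_m -> set T) :
  \bigcup_i V i = setT -> (forall i, noetherian_on (V i)) ->
  noetherian_on [set: T].
Proof.
move=> VT nV C cC dC; have {nV}[N NP] := choice (fun i => nV i C cC dC).
exists (\max_i N i)%N => j Nj x [_ Cx].
have [i _ Vx] : (\bigcup_i V i) x by rewrite VT.
apply: (NP i j); last first.
  by split=> //; apply: chain_homo Cx => //; exact: (leq_bigmax i).
by apply: leq_trans Nj; exact: (leq_bigmax i).
Qed.

(** Continuity of the inverse [d] prevents the closure taken on the chart side from adding points of
    [V]. Both chain conditions and Chevalley's theorem pass between a space and its charts by
    this. *)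
Lemma retraction_closure T S (V : set T) (c : T -> S) (d : S -> T)
    (C : set T) : {in V, cancel c d} -> continuous_on (c @` V) d ->
  closed C -> forall v, V v -> closure (c @` (C `&` V)) (c v) -> C v.
Proof.
move=> cK cd cC v Vv clv; rewrite -(cK v (mem_set Vv)).
apply: (continuous_on_closed cd cC); first exact: imageP.
apply: closureS clv => _ [w [Cw Vw] <-]; split; first exact: imageP.
by rewrite /preimage/= cK ?inE.
Qed.

Lemma noetherian_retraction T S (V : set T) (c : T -> S) (d : S -> T) :
  {in V, cancel c d} -> continuous_on (c @` V) d ->
  noetherian_on [set: S] -> noetherian_on V.
Proof.
move=> cK cd nS C cC dC.
have [||N NP] := nS (fun i => closure (c @` (C i `&` V))).
- by move=> i; exact: closed_closure.
- by move=> i; apply/closureS/image_subset => x [/dC].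
exists N => i Ni v [Vv Cv].
apply: (retraction_closure cK cd (cC i) Vv); apply: NP => //; split=> //.
by apply: subset_closure; exists v.
Qed.

Lemma noetherian_min T (P : set (set T)) : noetherian_on [set: T] ->
  P `<=` closed -> P !=set0 ->
  exists2 C, P C & forall D, P D -> D `<=` C -> C `<=` D.
Proof.
move=> nT cP [C0 PC0]; apply: contrapT => noC.
have nxt (C : {C | P C}) : exists D : {C | P C},
    sval D `<=` sval C /\ ~ (sval C `<=` sval D).
  case: C => C PC; apply: contrapT => noD; apply: noC; exists C => // D PD DC.
  by apply: contrapT => nCD; apply: noD; exists (exist _ D PD).
have [f fP] := choice nxt.
pose C i := sval (iter i f (exist _ C0 PC0)).
have [||N NP] := nT C.
- by move=> i; apply: cP; exact: svalP.
- by move=> i; exact: (proj1 (fP _)).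
apply: (proj2 (fP (iter N f (exist _ C0 PC0)))) => x Cx.
by apply: (NP N.+1 (leqnSn N)).
Qed.

(** The preimages of [Z] under the iterates of [t] decrease, because [s] preserves [Z]. If they are
    stationary from [N] on, the point [s^N z] of the [N]-th one lies in the next one, which says
    that [t z] is in [Z]. *)
Lemma noetherian_stable T (Z : set T) (s t : T -> T) :
  noetherian_on [set: T] -> closed Z -> continuous t ->
  cancel s t -> cancel t s -> s @` Z `<=` Z -> t @` Z `<=` Z.
Proof.
move=> nT cZ ct sK tK sZ.
have [||N NP] := nT (fun i => iter i t @^-1` Z).
- elim=> [|i IH] //=; rewrite (_ : _ @^-1` _ = t @^-1` (iter i t @^-1` Z)).
    by move/continuous_closedP: ct; apply.
  by apply/seteqP; split=> x; rewrite /preimage/= -iterSr.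
- by move=> i x Zx; apply: sZ; exists (t (iter i t x)).
move=> _ [z Zz <-].
have sN : iter N t (iter N s z) = z.
  by elim: (N) => // n IH; rewrite iterSr iterS sK.
have := NP N.+1 (leqnSn N) (iter N s z).
by rewrite /preimage/= sN; exact.
Qed.

(* A weak form of finite dimensionality. *)
Definition irreducible_acc T : Prop :=
  forall Z : nat -> set T, (forall i, closed (Z i) /\ irreducible_set (Z i)) ->
    (forall i, Z i `<=` Z i.+1) -> exists i, Z i.+1 `<=` Z i.

(** One chart is enough: a point of the first set lies in all of them, and an irreducible set that
    meets the open [V] is contained in a closed set as soon as its trace on [V] is. *)
Lemma irreducible_acc_local T :
  (forall x : T, exists (S : topologicalType) (V : set T) (c : T -> S)
      (d : S -> T), [/\ [/\ open V, V x & irreducible_acc S],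
      {in V, cancel c d}, continuous_on V c & continuous_on (c @` V) d]) ->
  irreducible_acc T.
Proof.
move=> loc Z irrZ incZ; have [_ [[x Zx] _]] := irrZ 0%N.
have [S [V [c [d [[oV Vx accS] cK cc cd]]]]] := loc x.
have ZVi i : (Z i `&` V) x.
  by split=> //; elim: i => // i; exact: incZ.
have [||i ZS] := accS (fun i => closure (c @` (Z i `&` V))).
- move=> i; split; first exact: closed_closure.
  apply: irreducible_set_closure; apply: irreducible_set_image.
    by apply: continuous_onS cc => y [].
  by apply: irreducible_setI => //; [case: (irrZ i)|exists x].
- by move=> i; apply/closureS/image_subset => y [/incZ].
exists i; have [cZi irrZi] := irrZ i.+1.
have [||y Zy||] := proj2 irrZi (Z i) (~` V).
- by case: (irrZ i).
- by rewrite closedC.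
- have [Vy|] := pselect (V y); last by right.
  left; apply: (retraction_closure cK cd (proj1 (irrZ i)) Vy).
  by apply: ZS; apply: subset_closure; exists y.
- by [].
- by move=> /(_ x (proj1 (ZVi _))).
Qed.

Lemma irreducible_acc_max T (P : set (set T)) : irreducible_acc T ->
  (forall C, P C -> closed C /\ irreducible_set C) -> P !=set0 ->
  exists2 C, P C & forall D, P D -> C `<=` D -> D `<=` C.
Proof.
move=> aT cP [C0 PC0]; apply: contrapT => noC.
have nxt (C : {C | P C}) : exists D : {C | P C},
    sval C `<=` sval D /\ ~ (sval D `<=` sval C).
  case: C => C PC; apply: contrapT => noD; apply: noC; exists C => // D PD DC.
  by apply: contrapT => nCD; apply: noD; exists (exist _ D PD).
have [f fP] := choice nxt.
pose C i := sval (iter i f (exist _ C0 PC0)).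
have [||i Ci] := aT C.
- by move=> i; apply: cP; exact: svalP.
- by move=> i; exact: (proj1 (fP _)).
exact: (proj2 (fP (iter i f (exist _ C0 PC0)))) Ci.
Qed.

End ChainConditions.

(** * Affine space: Hilbert's basis theorem *)

Section ZariskiTopology.
Context (k : fieldType) (n : nat).
Implicit Types (p q : mpoly n k) (x : affine_carrier k n).
Implicit Types (C U : set (affine_carrier k n)).

Lemma pevalC c x : peval (mpolyC n c) x = c.
Proof. exact: mevalC. Qed.

Lemma pevalD p q x : peval (p + q) x = peval p x + peval q x.
Proof. exact: mevalD. Qed.

Lemma pevalB p q x : peval (p - q) x = peval p x - peval q x.
Proof. exact: mevalB. Qed.

Lemma pevalM p q x : peval (p * q) x = peval p x * peval q x.
Proof. exact: mevalM. Qed.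

Lemma pevalZ c p x : peval (c *: p) x = c * peval p x.
Proof. exact: mevalZ. Qed.

Lemma pevalX (i : 'I_n) x : peval (mpolyX k (mnm1 i)) x = (x : 'rV[k]_n) ord0 i.
Proof. exact: mevalXU. Qed.

Lemma zariski_openP U : open U <-> zariski_open U.
Proof. by []. Qed.

Lemma zariski_closedP C : closed C <-> exists S, C = zero_locus S.
Proof. by rewrite -openC zariski_openP /zariski_open setCK. Qed.

Lemma zariski_basic_open q : open [set x : affine_carrier k n | peval q x != 0].
Proof.
exists [set q]; apply/seteqP; split=> y /=.
  by move=> /negP; rewrite negbK => /eqP qy _ ->.
by move=> /(_ q erefl) ->; rewrite eqxx.
Qed.

Lemma zariski_basicP U x : open U -> U x ->
  exists2 q, peval q x != 0 & forall y, peval q y != 0 -> U y.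
Proof.
move=> [S US] Ux; have : ~ zero_locus S x by rewrite -US => /(_ Ux).
move=> /existsNP[q /not_implyP[Sq qx]]; exists q; first exact/eqP.
move=> y qy; rewrite -[U]setCK US => /(_ q Sq) qy0.
by rewrite qy0 eqxx in qy.
Qed.

Definition vanishing C : set (mpoly n k) := [set p | forall x, C x -> peval p x = 0].

Lemma closed_vanishing C C' : closed C -> vanishing C `<=` vanishing C' -> C' `<=` C.
Proof.
move=> /zariski_closedP[S ->] SC' x C'x p Sp; apply: SC' => //.
by move=> y; apply.
Qed.

Lemma irreducible_vanishingM C p q : irreducible_set C ->
  vanishing C (p * q) -> vanishing C p \/ vanishing C q.
Proof.
have cl r : closed [set x : affine_carrier k n | peval r x = 0].
  apply/zariski_closedP; exists [set r].
  by apply/seteqP; split=> x /= => [rx _ ->|]; last exact.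
move=> [_ irr] pq; apply: irr; [exact: cl|exact: cl|] => x /pq.
by rewrite pevalM => /eqP; rewrite mulf_eq0 => /orP[/eqP|/eqP]; [left|right].
Qed.

End ZariskiTopology.

Section HilbertBasis.

Lemma nondecreasing_subseq (u : nat -> nat) :
  exists2 phi : nat -> nat, (forall i, phi i < phi i.+1)%N &
    (forall i j, i <= j -> u (phi i) <= u (phi j))%N.
Proof.
(* [m a] is a position, at or after [a], where [u] is minimal on that tail; restarting just after
   each such position gives the subsequence. *)
have [m mP] : {m : nat -> nat & forall a,
    (a <= m a /\ forall i, a <= i -> u (m a) <= u i)%N}.
  apply: (@choice _ _ (fun a b => (a <= b /\ forall i, a <= i -> u b <= u i)%N)).
  move=> a; pose P v := `[< exists2 i, (a <= i)%N & u i = v >].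
  have exP : exists v, P v by exists (u a); apply/asboolP; exists a.
  have [_ /asboolP[b ab <-] minb] := ex_minnP exP.
  by exists b; split=> // i ai; apply: minb; apply/asboolP; exists i.
pose phi i := iter i (fun a => m a.+1) (m 0%N).
exists phi => [i|]; first by case: (mP (phi i).+1).
apply: (@homo_leq _ (u \o phi) leq) => [//|x y z|[|i]]; first exact: leq_trans.
  by apply: (proj2 (mP 0%N)).
apply: (proj2 (mP (phi i).+1)).
by apply: leq_trans (proj1 (mP (phi i.+1).+1)); apply/leqW/(proj1 (mP _)).
Qed.

(** Subsequences are refined one coordinate at a time until all coordinates are nondecreasing; the
    first two terms are then comparable. *)
Lemma dickson n (f : nat -> multinom n) :
  exists i j, (i < j)%N /\ lem (f i) (f j).
Proof.
have [phi phiS phiP] : exists2 phi : nat -> nat, (forall i, phi i < phi i.+1)%N &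
    forall c : 'I_n, c \in enum 'I_n ->
    forall i j, (i <= j)%N -> (f (phi i) c <= f (phi j) c)%N.
  elim: (enum 'I_n) => [|c s [phi phiS phiP]]; first by exists id.
  have [psi psiS psiP] := nondecreasing_subseq (fun i => f (phi i) c).
  have phi_mono : {homo phi : i j / (i < j)%N} by exact: homo_ltn ltn_trans _.
  have psi_mono : {homo psi : i j / (i <= j)%N}.
    by apply: homo_leq => // [x y z|i]; [exact: leq_trans|exact: ltnW].
  exists (phi \o psi) => [i|c']; first by apply: phi_mono.
  rewrite inE => /predU1P[->|c's] i j ij; first exact: psiP.
  by apply: phiP => //; exact: psi_mono.
exists (phi 0%N), (phi 1%N); split=> //.
by apply/mnm_lepP => c; apply: phiP => //; rewrite mem_enum.
Qed.

Lemma mlead_reduce (k : fieldType) n (p q : mpoly n k) :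
  p != 0 -> q != 0 -> lem (mlead q) (mlead p) ->
  exists r : mpoly n k, p - r * q = 0 \/ (mlead (p - r * q) < mlead p)%O.
Proof.
move=> p0 q0 qp; pose X := mpolyX k (mnm_sub (mlead p) (mlead q)) : mpoly n k.
have X0 : X != 0 by rewrite -mleadc_eq0 mleadXm mcoeffX eqxx oner_eq0.
have leadXq : mlead (X * q) = mlead p by rewrite mleadM // mleadXm submK.
have Xq0 : mcoeff (mlead p) (X * q) != 0.
  by rewrite -leadXq mleadc_eq0 mulf_neq0.
pose c := mcoeff (mlead p) p / mcoeff (mlead p) (X * q).
exists (c *: X); rewrite -scalerAl; set d := p - _.
have dp : mcoeff (mlead p) d = 0.
  by rewrite mcoeffB mcoeffZ divfK ?subrr.
have : (mlead d <= mlead p)%O.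
  apply: le_trans (mleadB_le _ _) _.
  rewrite leUx lexx /=.
  by apply: le_trans (mleadZ_le _ _) _; rewrite leadXq.
(* If the leading monomial did not drop, the coefficient there, which was cancelled, would be the
   leading one; so [d] is zero. *)
rewrite le_eqVlt => /predU1P[dlead|]; last by right.
by left; apply/eqP; rewrite -mleadc_eq0 dlead dp.
Qed.

(** Hilbert's basis theorem by minimal leading monomials. In a chain that never stops, [g N] has
    least leading monomial among the polynomials that vanish on some set of the chain but not on
    [C N]. By Dickson's lemma an earlier choice divides a later one in leading monomial, and one
    division step contradicts the minimality of the later. *)
Lemma affine_noetherian (k : fieldType) n :
  noetherian_on [set: affine_carrier k n].
Proof.
move=> C cC dC; apply: contrapT => nN.
have Cle := chain_homo dC.
have VS i j : (i <= j)%N -> vanishing (C i) `<=` vanishing (C j).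
  by move=> ij p pi x /(Cle _ _ ij); exact: pi.
pose bad N (p : mpoly n k) := ~ vanishing (C N) p /\ exists i, vanishing (C i) p.
have [g gP] : {g : nat -> mpoly n k & forall N, bad N (g N) /\
    forall p, bad N p -> ~ (mlead p < mlead (g N))%O}.
  apply: (@choice _ _ (fun N gN => bad N gN /\
    forall p, bad N p -> ~ (mlead p < mlead gN)%O)) => N.
  have [p0 bp0] : exists p, bad N p.
    apply: contrapT => nbad; apply: nN; exists N => i Ni.
    rewrite setTI; apply: closed_vanishing => // p pi.
    by apply: contrapT => pN; apply: nbad; exists p; split=> //; exists i.
  apply: contrapT => /forallNP nmin; move: bp0.
  elim/mleadrect: p0 => p IH bp; apply: (nmin p); split=> // q bq qp.
  exact: (IH q qp).
have [nxt nxtP] : {nxt : nat -> nat & forall N,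
    (N <= nxt N)%N /\ vanishing (C (nxt N)) (g N)}.
  apply: (@choice _ _ (fun N i => (N <= i)%N /\ vanishing (C i) (g N))) => N.
  have [[_ [i gi]] _] := gP N; exists (maxn N i); rewrite leq_maxl.
  by split=> //; apply: VS gi; exact: leq_maxr.
(* Levels are spaced so that [g (M i)] vanishes on all later [C (M j)]; subtracting its multiples
   from [g (M j)] thus keeps a polynomial bad at level [M j]. *)
pose M i := iter i nxt 0%N.
have [i [j [ij lij]]] := dickson (fun i => mlead (g (M i))).
have [[gj [l gjl]] minj] := gP (M j); have [[gi _] _] := gP (M i).
have M_mono : {homo M : a b / (a <= b)%N}.
  apply: homo_leq => // [x y z|a]; [exact: leq_trans|exact: (proj1 (nxtP _))].
have gij : vanishing (C (M j)) (g (M i)).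
  by apply: VS (proj2 (nxtP (M i))); exact: (M_mono i.+1).
have nz N p : ~ vanishing (C N) p -> p != 0.
  by apply: contra_notN => /eqP -> x _; rewrite /peval meval0.
have [|||r rP] := @mlead_reduce k n (g (M j)) (g (M i)) => //;
  [exact: nz gj|exact: nz gi|].
have bad_r : bad (M j) (g (M j) - r * g (M i)).
  split.
    move=> van; apply: gj => x Cx; have := van x Cx.
    by rewrite pevalB pevalM (gij x Cx) mulr0 subr0.
  exists (maxn l (M j)) => x Cx; rewrite pevalB pevalM.
  rewrite (VS _ _ (leq_maxl l (M j)) _ gjl x Cx).
  by rewrite (VS _ _ (leq_maxr l (M j)) _ gij x Cx) mulr0 subr0.
case: rP => [r0|]; last exact: minj.
by case: bad_r => + _; apply; rewrite r0 => x _; rewrite /peval meval0.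
Qed.

(** A minimal locus among those of finite subsets of [S] cannot shrink when one more element of [S]
    is added. Finiteness allows membership in [C] to be expressed by a first-order formula. *)
Lemma zero_locus_finite (k : fieldType) n (C : set (affine_carrier k n)) :
  closed C -> exists s : seq (mpoly n k), C = zero_locus [set` s].
Proof.
move=> /zariski_closedP[S CS].
pose P (D : set (affine_carrier k n)) :=
  exists2 s : seq (mpoly n k), [set` s] `<=` S & D = zero_locus [set` s].
have [||_ [s sS ->] smin] := @noetherian_min _ P (@affine_noetherian k n).
- by move=> _ [s _ ->]; apply/zariski_closedP; exists [set` s].
- by exists (zero_locus [set` [::]]), [::].
exists s; rewrite CS; apply/seteqP; split=> x; first by move=> h p /sS /h.
move=> sx p Sp; have : zero_locus [set` p :: s] x.
  apply: (smin _ _ _ x sx).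
    exists (p :: s) => // q /=; rewrite inE => /predU1P[->//|qs].
    exact: sS.
  by move=> y h q qs; apply: h; rewrite /= inE [q \in s]qs orbT.
by apply; rewrite /= inE eqxx.
Qed.

End HilbertBasis.

(** * Affine space: dimension *)

Section Dimension.
Context (k : fieldType) (n : nat).
Implicit Types (p q f : mpoly n k) (fs : seq (mpoly n k)).

Fixpoint exponents (N d : nat) : seq (seq nat) :=
  if d is d'.+1 then [seq j :: a | j <- iota 0 N, a <- exponents N d']
  else [:: [::]].

Fixpoint monomial fs (a : seq nat) : mpoly n k :=
  match fs, a with
  | f :: fs', j :: a' => f ^+ j * monomial fs' a'
  | _, _ => 1
  end.

Lemma size_exponents N d : size (exponents N d) = (N ^ d)%N.
Proof. by elim: d => //= d IH; rewrite size_allpairs IH size_iota expnS. Qed.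

Lemma uniq_exponents N d : uniq (exponents N d).
Proof.
elim: d => //= d IH; apply: allpairs_uniq; rewrite ?iota_uniq//.
by move=> [j a] [j' a'] _ _ /= [-> ->].
Qed.

(** A strictly increasing chain, largest set outermost, with polynomials witnessing strictness. They
    turn out to be algebraically independent, which bounds the length by [n]. *)
Inductive flag : set (affine_carrier k n) -> seq (mpoly n k) -> Prop :=
| FlagNil Z : Z !=set0 -> flag Z [::]
| FlagCons Z Z' f fs : irreducible_set Z' -> Z `<=` Z' -> vanishing Z f ->
    ~ vanishing Z' f -> flag Z fs -> flag Z' (f :: fs).

(* Restricting a relation to the smaller set [Z] kills the terms divisible by [f];
   in the remaining ones [f] can be cancelled, since [Z'] is irreducible. *)
Lemma flag_independent Z fs : flag Z fs -> forall N (c : seq nat -> k),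
  vanishing Z (\sum_(a <- exponents N (size fs)) c a *: monomial fs a) ->
  forall a, a \in exponents N (size fs) -> c a = 0.
Proof.
elim=> {Z fs} [Z [x Zx] N c|Z Z' f fs irrZ' ZZ' fZ fZ' _ IH N c].
  move=> /(_ x Zx); rewrite /= big_seq1 pevalZ /peval meval1 mulr1 => c0 a.
  by rewrite inE => /eqP ->.
pose g (c : seq nat -> k) :=
  \sum_(a <- exponents N (size fs)) c a *: monomial fs a.
have key M (C : nat -> seq nat -> k) :
    vanishing Z' (\sum_(0 <= j < M) f ^+ j * g (C j)) ->
    forall j a, (j < M)%N -> a \in exponents N (size fs) -> C j a = 0.
  elim: M C => // M IHM C; rewrite big_nat_recl// expr0 mul1r.
  under eq_bigr do rewrite exprS -mulrA.
  rewrite -mulr_sumr => van.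
  have C0 a : a \in exponents N (size fs) -> C 0%N a = 0.
    apply: IH => x Zx; have := van x (ZZ' x Zx).
    by rewrite pevalD pevalM (fZ x Zx) mul0r addr0.
  have g0 : g (C 0%N) = 0.
    by rewrite /g big_seq big1// => a /C0 ->; rewrite scale0r.
  move: van; rewrite g0 add0r => /(irreducible_vanishingM irrZ')[//|/IHM CS].
  by move=> [|j] a jM aE; [exact: C0|exact: (CS j)].
rewrite /= big_allpairs_dep /= => van a /allpairsP[[j b] /= [jN bE ->]].
apply: (key N (fun j b => c (j :: b))) => //; last first.
  by rewrite mem_iota /= in jN.
move=> x Zx; rewrite -[RHS](van x Zx); congr peval.
rewrite /index_iota subn0; apply: eq_bigr => i _; rewrite mulr_sumr.
by apply: eq_bigr => b' _; rewrite scalerAr.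
Qed.

Lemma msizeM_bound p q A B : (msize p <= A.+1)%N -> (msize q <= B.+1)%N ->
  (msize (p * q) <= (A + B).+1)%N.
Proof.
have [->|p0] := eqVneq p 0; first by rewrite mul0r mmeasure0.
have [->|q0] := eqVneq q 0; first by rewrite mulr0 mmeasure0.
rewrite msizeM// -!mlead_deg// !ltnS addSn addnS /= ltnS.
exact: leq_add.
Qed.

Lemma msize_monomial N D fs a : all (fun f => (msize f <= D.+1)%N) fs ->
  a \in exponents N (size fs) ->
  (msize (monomial fs a) <= (size fs * (N * D)).+1)%N.
Proof.
elim: fs a => [|f fs IH] a /=; first by rewrite msize1.
move=> /andP[fD fsD] /allpairsP[[j b] /= [jN bE ->]] /=.
rewrite mulSn; apply: msizeM_bound; last exact: IH.
have fj : (msize (f ^+ j) <= (j * D).+1)%N.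
  elim: (j) => [|i IHi]; first by rewrite expr0 msize1.
  by rewrite exprS mulSn; apply: msizeM_bound.
apply: leq_trans fj _; rewrite ltnS leq_mul2r.
by rewrite mem_iota in jN; rewrite ltnW ?orbT.
Qed.

(** A crude bound, but its exponent [n] is below the number of polynomials in [dependent_monomials],
    which is all the growth comparison requires. *)
Lemma card_bmultinom M : (#|{: bmultinom n M.+1}| <= M.+1 ^ n)%N.
Proof.
have lt (m : bmultinom n M.+1) i : (bmnm m i < M.+1)%N.
  apply: leq_ltn_trans (bmdeg m).
  by rewrite mdegE (bigD1 i)//= leq_addr.
pose h (m : bmultinom n M.+1) : {ffun 'I_n -> 'I_M.+1} := [ffun i => Ordinal (lt m i)].
have h_inj : injective h.
  move=> m m' /ffunP hm; apply/val_inj/mnmP => i.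
  by have := hm i; rewrite !ffunE => /(congr1 val).
by have := leq_card h h_inj; rewrite card_ffun !card_ord.
Qed.

Lemma dependent_monomials fs : (n < size fs)%N -> exists N (c : seq nat -> k),
  \sum_(a <- exponents N (size fs)) c a *: monomial fs a = 0 /\
  exists2 a, a \in exponents N (size fs) & c a != 0.
Proof.
move=> nfs; set d := size fs.
pose D := \max_(f <- fs) msize f.
have fsD : all (fun f => (msize f <= D.+1)%N) fs.
  by apply/allP => f ffs; apply/leqW; exact: leq_bigmax_seq.
(* As [M + 1] is at most [N] times [d * D + 1], the number of monomials of degree at most [M] is
   bounded by [N ^ n] times [(d * D + 1) ^ n]. This choice of [N] makes it less than [N ^ n.+1],
   hence than [N ^ d]. *)
pose N := ((d * D).+1 ^ n).+1; pose M := (d * (N * D))%N.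
pose E := exponents N d.
(* There are more monomials in [fs] with exponents below [N] than monomials of
   the degrees, at most [M], that they involve. *)
have lt_card : (#|{: bmultinom n M.+1}| < size E)%N.
  apply: leq_ltn_trans (card_bmultinom M) _; rewrite size_exponents.
  apply: (@leq_trans (N ^ n.+1)); last by rewrite leq_pexp2l.
  apply: (@leq_ltn_trans ((N * (d * D).+1) ^ n)).
    have MN : (M.+1 <= N * (d * D).+1)%N by rewrite mulnS /M mulnCA -add1n leq_add2r.
    by elim: (n) => // i IHi; rewrite !expnS leq_mul.
  by rewrite expnMn expnSr ltn_pmul2l ?expn_gt0.
exists N.
(* Each row lists the coefficients of one monomial in [fs]; with more rows than columns there is a
   nonzero vector in the left kernel, i.e. a linear relation. *)
pose A : 'M[k]_(size E, #|{: bmultinom n M.+1}|) :=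
  \matrix_(i, j) mcoeff (enum_val j : bmultinom n M.+1) (monomial fs (nth [::] E i)).
have : kermx A != 0.
  rewrite kermx_eq0 /row_free neq_ltn.
  by rewrite (leq_ltn_trans (rank_leq_col A)).
move=> /rowV0Pn[u /sub_kermxP uA /rV0Pn[i0 ui0]].
pose c a := if insub (index a E) is Some i then u ord0 i else 0.
have cE (i : 'I_(size E)) : c (nth [::] E i) = u ord0 i.
  by rewrite /c index_uniq ?uniq_exponents// valK.
exists c; split; last by exists (nth [::] E i0); [exact: mem_nth|rewrite cE].
rewrite (big_nth [::]) big_mkord -/E.
set P := \sum_(i < _) _.
have szP : (msize P <= M.+1)%N.
  apply: leq_trans (mmeasure_sum _ _ _ _) _; apply/bigmax_leqP => i _.
  apply: leq_trans (msizeZ_le _ _) _; apply: msize_monomial => //.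
  exact: mem_nth.
apply/mpolyP => m; rewrite mcoeff0; apply: contrapT => /eqP Pm.
have mM : (mdeg m < M.+1)%N.
  by apply: leq_trans szP; apply: msize_mdeg_lt; rewrite mcoeff_msupp.
move: Pm => /eqP; apply.
have /matrixP/(_ ord0 (enum_rank (BMultinom mM))) := uA.
rewrite !mxE => uA0; rewrite -[RHS]uA0 /P raddf_sum /=; apply: eq_bigr => i _.
by rewrite mcoeffZ cE mxE enum_rankK.
Qed.

(** A chain strict at every step provides [n.+1] algebraically independent polynomials in [n]
    variables. *)
Lemma affine_irreducible_acc : irreducible_acc (affine_carrier k n).
Proof.
move=> Z irrZ incZ; apply: contrapT => /forallNP strict.
have [f fP] : {f : nat -> mpoly n k & forall i, vanishing (Z i) (f i) /\
    ~ vanishing (Z i.+1) (f i)}.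
  apply: (@choice _ _ (fun i p => vanishing (Z i) p /\ ~ vanishing (Z i.+1) p)).
  move=> i; apply: contrapT => /forallNP nf; apply: (strict i).
  apply: closed_vanishing; first by case: (irrZ i).
  by move=> p pi; apply: contrapT => pS; apply: (nf p).
have flagZ d : exists2 fs, size fs = d & flag (Z d) fs.
  elim: d => [|d [fs <- fl]].
    by exists [::] => //; apply: FlagNil; case: (irrZ 0%N) => _ [].
  exists (f (size fs) :: fs) => //; have [fd fdS] := fP (size fs).
  by apply: FlagCons fl => //; case: (irrZ (size fs).+1).
have [fs fsz /flag_independent indep] := flagZ n.+1.
have [|N [c [c0 [a aE]]]] := @dependent_monomials fs; first by rewrite fsz.
rewrite (indep N c _ a aE) ?eqxx// => x _.
by rewrite c0 /peval meval0.
Qed.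

End Dimension.

(** * Affine space: Chevalley's theorem *)

Section Constructibility.
Context (k : closedFieldType) (m : nat).
Implicit Types (E Z : set (affine_carrier k m)) (y : affine_carrier k m).

(* Constructible sets have this property, it is stable under boolean
   combinations, and for a dense [E] it provides an open subset of [Z]. *)
Definition generically_decided E : Prop :=
  forall Z, irreducible_set Z -> exists U, [/\ open U, Z `&` U !=set0 &
    Z `&` U `<=` E \/ Z `&` U `<=` ~` E].

Lemma generically_decidedC E : generically_decided E -> generically_decided (~` E).
Proof.
move=> dE Z /dE[U [oU ZU h]]; exists U; split=> //.
by rewrite setCK; case: h; [right|left].
Qed.

Lemma generically_decidedI E E' : generically_decided E -> generically_decided E' ->
  generically_decided (E `&` E').
Proof.
move=> dE dE' Z irrZ; have [U [oU ZU h]] := dE Z irrZ.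
have [U' [oU' ZU' h']] := dE' Z irrZ.
exists (U `&` U'); split; [exact: openI|exact: irreducible_setI2|].
case: h => h; last by right=> x [Zx [Ux _]] [Ex _]; exact: (h x).
case: h' => h'; last by right=> x [Zx [_ Ux]] [_ Ex]; exact: (h' x).
by left=> x [Zx [Ux U'x]]; split; [exact: h|exact: h'].
Qed.

Lemma generically_decidedU E E' : generically_decided E -> generically_decided E' ->
  generically_decided (E `|` E').
Proof.
move=> dE dE'; rewrite -[_ `|` _]setCK setCU.
by apply/generically_decidedC/generically_decidedI; exact: generically_decidedC.
Qed.

Lemma generically_decided_closed E : closed E -> generically_decided E.
Proof.
move=> cE Z irrZ; have [ZE|] := pselect (Z `<=` E).
  exists setT; rewrite setIT; split; [exact: openT|by case: irrZ|by left].
move=> /existsNP[x /not_implyP[Zx Ex]]; exists (~` E).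
by rewrite openC; split=> //; [exists x|right=> y []].
Qed.

(** Only the first alternative survives, since an open set meeting the closure of [E] meets [E]. *)
Lemma generically_decided_dense E : generically_decided E ->
  irreducible_set (closure E) ->
  exists U, [/\ open U, E `&` U !=set0 & closure E `&` U `<=` E].
Proof.
move=> dE /dE[U [oU [x [clx Ux]] h]].
have [y [Ey Uy]] := clx U (open_nbhs_nbhs (conj oU Ux)).
exists U; split=> //; first by exists y.
by case: h => // h; case: (h y) => //; split=> //; exact: subset_closure.
Qed.

Definition point_env y : seq k := [seq (y : 'rV[k]_m) ord0 i | i <- enum 'I_m].

Lemma size_point_env y : size (point_env y) = m.
Proof. by rewrite size_map size_enum_ord. Qed.

Lemma nth_point_env y (i : 'I_m) : nth 0 (point_env y) i = (y : 'rV[k]_m) ord0 i.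
Proof. by rewrite (nth_map i) ?size_enum_ord// nth_ord_enum. Qed.

Lemma eval_point_env (t : GRing.term k) : GRing.rterm t ->
  exists p : mpoly m k, forall y, GRing.eval (point_env y) t = peval p y.
Proof.
elim: t => //=.
- move=> i _; have [im|mi] := ltnP i m; last first.
    by exists 0 => y; rewrite nth_default ?size_point_env// /peval meval0.
  by exists (mpolyX k (mnm1 (Ordinal im))) => y; rewrite pevalX -nth_point_env.
- by move=> c _; exists (mpolyC m c) => y; rewrite pevalC.
- by move=> n _; exists (mpolyC m n%:R) => y; rewrite pevalC.
- move=> t IHt u IHu /andP[/IHt[p pP] /IHu[q qP]].
  by exists (p + q) => y; rewrite pevalD pP qP.
- by move=> t IHt /IHt[p pP]; exists (- p) => y; rewrite pP /peval mevalN.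
- by move=> t IHt n /IHt[p pP]; exists (p *+ n) => y; rewrite pP /peval mevalMn.
- move=> t IHt u IHu /andP[/IHt[p pP] /IHu[q qP]].
  by exists (p * q) => y; rewrite pevalM pP qP.
- by move=> t IHt n /IHt[p pP]; exists (p ^+ n) => y; rewrite pP /peval rmorphXn.
Qed.

Lemma generically_decided_qf (f : GRing.formula k) :
  GRing.qf_form f && GRing.rformula f ->
  generically_decided [set y | GRing.qf_eval (point_env y) f].
Proof.
elim: f => //=.
- move=> [] _; apply: generically_decided_closed.
    by rewrite (_ : mkset _ = setT)//; exact/seteqP.
  rewrite (_ : mkset _ = set0); first exact: closed0.
  by apply/seteqP; split.
- move=> t u /andP[/eval_point_env[p pP] /eval_point_env[q qP]].
  apply: generically_decided_closed; apply/zariski_closedP; exists [set p - q].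
  apply/seteqP; split=> y /=; rewrite pP qP.
    by move=> /eqP pq _ ->; rewrite pevalB pq subrr.
  by move=> /(_ _ erefl) /eqP; rewrite pevalB subr_eq0.
- move=> f IHf g IHg /andP[/andP[qf qg] /andP[rf rg]].
  rewrite (_ : mkset _ = [set y | GRing.qf_eval (point_env y) f] `&`
    [set y | GRing.qf_eval (point_env y) g]).
    by apply: generically_decidedI; [apply: IHf; rewrite qf|apply: IHg; rewrite qg].
  by apply/seteqP; split=> y /= /andP.
- move=> f IHf g IHg /andP[/andP[qf qg] /andP[rf rg]].
  rewrite (_ : mkset _ = [set y | GRing.qf_eval (point_env y) f] `|`
    [set y | GRing.qf_eval (point_env y) g]).
    by apply: generically_decidedU; [apply: IHf; rewrite qf|apply: IHg; rewrite qg].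
  by apply/seteqP; split=> y /= /orP.
- move=> f IHf g IHg /andP[/andP[qf qg] /andP[rf rg]].
  rewrite (_ : mkset _ = ~` [set y | GRing.qf_eval (point_env y) f] `|`
    [set y | GRing.qf_eval (point_env y) g]).
    apply: generically_decidedU; last by apply: IHg; rewrite qg.
    by apply: generically_decidedC; apply: IHf; rewrite qf.
  apply/seteqP; split=> y /=; first by rewrite implybE => /orP[/negP|]; [left|right].
  by rewrite implybE => -[/negP|] ->; rewrite ?orbT.
- move=> f IHf /IHf /generically_decidedC; congr generically_decided.
  by apply/seteqP; split=> y /= /negP.
Qed.

Lemma generically_decided_formula (f : GRing.formula k) : GRing.rformula f ->
  generically_decided [set y | GRing.holds (point_env y) f].
Proof.
move=> rf.
have wf := @ClosedFieldQE.wf_ex_elim k.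
have ok := ClosedFieldQE.holds_ex_elim (@solve_monicpoly k).
have qf := GRing.quantifier_elim_wf wf rf.
have := generically_decided_qf qf; congr generically_decided.
apply/seteqP; split=> y /= /(GRing.quantifier_elim_rformP wf ok (point_env y) rf);
  exact.
Qed.

(** The offset [o] lets the coordinates of a source point follow those of a target point in one
    environment. *)
Lemma term_of_mpoly n (p : mpoly n k) (o : nat) : exists2 t : GRing.term k,
  GRing.rterm t & forall (e : seq k) (x : affine_carrier k n),
    (forall i : 'I_n, e`_(o + i) = (x : 'rV[k]_n) ord0 i) ->
    GRing.eval e t = peval p x.
Proof.
elim/mpolyind: p => [|c a p _ _ [t rt tP]].
  by exists (GRing.Const 0) => // e x _; rewrite /peval meval0.
have [u ru uP] : exists2 u : GRing.term k, GRing.rterm u &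
    forall (e : seq k) (x : affine_carrier k n),
    (forall i : 'I_n, e`_(o + i) = (x : 'rV[k]_n) ord0 i) ->
    GRing.eval e u = \prod_(i < n) (x : 'rV[k]_n) ord0 i ^+ a i.
  elim: (index_enum _) => [|i s [u ru uP]].
    by exists (GRing.Const 1) => // e x _; rewrite big_nil.
  exists (GRing.Mul (GRing.Exp (GRing.Var k (o + i)) (a i)) u) => //= e x ex.
  by rewrite big_cons ex (uP e x).
exists (GRing.Add (GRing.Mul (GRing.Const c) u) t) => [|e x ex] /=.
  by rewrite ru.
by rewrite pevalD pevalZ [peval (mpolyX _ _) _]mevalX (uP e x)// (tP e x).
Qed.

(* Chevalley's theorem for the rational map [num / den], by quantifier
   elimination. *)
Lemma generically_decided_image n (s : seq (mpoly n k)) (q : mpoly n k)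
    (num den : 'I_m -> mpoly n k) :
  generically_decided [set y | exists x : affine_carrier k n,
    [/\ zero_locus [set` s] x, peval q x != 0 &
        forall i, (y : 'rV[k]_m) ord0 i * peval (den i) x = peval (num i) x]].
Proof.
have /choice[tm tmP] (p : mpoly n k) : exists t : GRing.term k,
    GRing.rterm t /\ forall (e : seq k) (x : affine_carrier k n),
    (forall i : 'I_n, e`_(m + i) = (x : 'rV[k]_n) ord0 i) ->
    GRing.eval e t = peval p x.
  by have [t rt tP] := term_of_mpoly p m; exists t.
pose conj (T : Type) (r : seq T) F := foldr (fun x => GRing.And (F x)) (@GRing.Bool k true) r.
have conjP (T : eqType) (r : seq T) F e :
    GRing.holds e (conj T r F) <-> forall x, x \in r -> GRing.holds e (F x).
  elim: r => //= x r IH; split=> [[Fx /IH Fr] x'|h].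
    by rewrite inE => /predU1P[->//|/Fr].
  split; first by apply: h; rewrite mem_head.
  by apply/IH => x' x'r; apply: h; rewrite inE x'r orbT.
have conjr (T : Type) (r : seq T) F :
    (forall x, GRing.rformula (F x)) -> GRing.rformula (conj T r F).
  by move=> rF; elim: r => //= x r ->; rewrite rF.
(* Variables below [m] stand for [y] and stay free; the next [n] stand for [x] and are bound in
   [rE]. Denominators are multiplied out so that the terms contain no inverse. *)
pose f : GRing.formula k := GRing.And
  (conj _ s (fun p => GRing.Equal (tm p) (GRing.Const 0)))
  (GRing.And (GRing.Not (GRing.Equal (tm q) (GRing.Const 0)))
  (conj _ (enum 'I_m) (fun i : 'I_m =>
     GRing.Equal (GRing.Mul (GRing.Var k i) (tm (den i))) (tm (num i))))).
have rt p : GRing.rterm (tm p) by case: (tmP p).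
have rf : GRing.rformula f.
  by rewrite /= !conjr ?rt//= => [i|p]; rewrite !rt.
have rE : GRing.rformula (foldr GRing.Exists f (iota m n)) by elim: (iota m n).
have fP e (x : affine_carrier k n) y :
    (forall i : 'I_n, e`_(m + i) = (x : 'rV[k]_n) ord0 i) ->
    (forall i : 'I_m, e`_i = (y : 'rV[k]_m) ord0 i) ->
    GRing.holds e f <-> [/\ zero_locus [set` s] x, peval q x != 0 &
        forall i, (y : 'rV[k]_m) ord0 i * peval (den i) x = peval (num i) x].
  move=> ex ey; have ev p : GRing.eval e (tm p) = peval p x by apply: (tmP p).2.
  split=> [[/conjP sx [qx /conjP nd]]|[sx qx nd]].
    split=> [p ps||i]; first by have := sx p ps; rewrite /= ev.
      by apply/eqP; move: qx; rewrite /= ev.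
    by have := nd i (mem_enum _ i); rewrite /= !ev ey.
  split; first by apply/conjP => p ps; rewrite /= ev; exact: sx.
  split; first by rewrite /= ev; apply/eqP.
  by apply/conjP => i _; rewrite /= !ev ey nd.
have := generically_decided_formula rE; congr generically_decided.
apply/seteqP; split=> y /=.
  move/GRing.foldExistsP => [e ey fe]; exists (\row_i e`_(m + i)).
  apply/(fP e _ y) => // i; first by rewrite mxE.
  rewrite -nth_point_env ey// inE mem_iota negb_and -ltnNge.
  by rewrite ltn_ord.
move=> [x xP]; apply/GRing.foldExistsP.
exists (point_env y ++ [seq (x : 'rV[k]_n) ord0 i | i <- enum 'I_n]).
  move=> i; rewrite inE mem_iota nth_cat size_map size_enum_ord.
  case: (ltnP i m) => //= mi; rewrite -leqNgt => mni.
  by rewrite !nth_default ?size_point_env// size_map size_enum_ord leq_subRL.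
apply/(fP _ x y) => // i; rewrite nth_cat size_map size_enum_ord.
  rewrite ltnNge leq_addr /= addKn (nth_map i) ?size_enum_ord//.
  by rewrite nth_ord_enum.
by rewrite ltn_ord nth_point_env.
Qed.

End Constructibility.

(** * Regular maps *)

Lemma near_all (T : topologicalType) (x : T) (P : T -> Prop) :
  (forall y, P y) -> nbhs x P.
Proof. exact: nearW. Qed.

Lemma near_forall (T : topologicalType) (x : T) (I : finType) (P : I -> set T) :
  (forall i, nbhs x (P i)) -> nbhs x [set y | forall i, P i y].
Proof. exact: filter_forall. Qed.

Lemma nbhs_open (T : topologicalType) (x : T) (W : set T) :
  nbhs x W -> exists2 V, open_nbhs x V & V `<=` W.
Proof. by rewrite nbhsE. Qed.

Section RegularMaps.
Context {k : fieldType}.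
Implicit Types X Y Z : fspace k.

(** An [fspace] may carry any subsheaf of functions. These properties make its germs a ring in which
    a germ with nonzero value is invertible; they are established for affine spaces, products and
    prevarieties. *)
Record regular_ring X : Prop := RegularRing {
  regular_cst : forall (x : X) c, regular x (fun=> c);
  regularD : forall (x : X) f g, regular x f -> regular x g ->
    regular x (fun y => f y + g y);
  regularM : forall (x : X) f g, regular x f -> regular x g ->
    regular x (fun y => f y * g y);
  regularV : forall (x : X) f, regular x f -> f x != 0 ->
    regular x (fun y => (f y)^-1);
  regular_neq0 : forall (x : X) f, regular x f -> f x != 0 ->
    \forall y \near x, f y != 0 }.

Lemma regular_sum X (I : Type) (s : seq I) (x : X) (f : I -> X -> k) :
  regular_ring X -> (forall i, regular x (f i)) ->
  regular x (fun y => \sum_(i <- s) f i y).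
Proof.
move=> rX rf; elim: s => [|i s IH].
  by under eq_fun do rewrite big_nil; exact: regular_cst.
by under eq_fun do rewrite big_cons; exact: regularD.
Qed.

Lemma regular_prod X (I : Type) (s : seq I) (x : X) (f : I -> X -> k) :
  regular_ring X -> (forall i, regular x (f i)) ->
  regular x (fun y => \prod_(i <- s) f i y).
Proof.
move=> rX rf; elim: s => [|i s IH].
  by under eq_fun do rewrite big_nil; exact: regular_cst.
by under eq_fun do rewrite big_cons; exact: regularM.
Qed.

Lemma regularX X (x : X) f n : regular_ring X -> regular x f ->
  regular x (fun y => f y ^+ n).
Proof.
move=> rX rf; elim: n => [|n IH].
  by under eq_fun do rewrite expr0; exact: regular_cst.
by under eq_fun do rewrite exprS; exact: regularM.
Qed.

(** Regularity of the restriction to [A] for the induced structure: a pulled back function need only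
    agree on [A] with a regular function of the ambient space. *)
Definition regular_map_on X Y (A : set X) (f : X -> Y) : Prop :=
  continuous_on A f /\ forall x, A x -> forall h, regular (f x) h ->
    exists2 r : X -> k, regular x r & \forall y \near x, A y -> h (f y) = r y.

Lemma regular_map_onT X Y (f : X -> Y) : regular_map_on setT f <-> regular_map f.
Proof.
split=> [[/continuous_onT cf rf]|[cf rf]].
  split=> // x h /(rf x Logic.I)[r rx hr]; apply: regular_local rx.
  by apply: filterS hr => y /(_ Logic.I).
split; first exact/continuous_onT.
by move=> x _ h /rf rx; exists (h \o f) => //; exact: nearW.
Qed.

Lemma regular_map_onS X Y (A B : set X) (f : X -> Y) :
  A `<=` B -> regular_map_on B f -> regular_map_on A f.
Proof.
move=> AB [cf rf]; split; first exact: continuous_onS cf.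
move=> x Ax h /(rf x (AB x Ax))[r rx hr]; exists r => //.
by apply: filterS hr => y + /AB; apply.
Qed.

Lemma continuous_on_nbhs (S T : topologicalType) (A : set S) (f : S -> T) :
  continuous_on A f -> forall x, A x -> forall W, nbhs (f x) W ->
  \forall y \near x, A y -> W (f y).
Proof.
move=> cf x Ax W; rewrite nbhsE => -[V [oV Vx] VW].
by apply: filterS (cf x Ax V oV Vx) => y + /[dup] Ay => /[apply] /VW.
Qed.

Lemma regular_map_on_comp X Y Z (A : set X) (B : set Y) (f : X -> Y) (g : Y -> Z) :
  regular_map_on A f -> regular_map_on B g -> (forall x, A x -> B (f x)) ->
  regular_map_on A (g \o f).
Proof.
move=> [cf rf] [cg rg] AB; split=> x Ax.
  move=> V oV Vx; have := continuous_on_nbhs cf Ax (cg _ (AB x Ax) V oV Vx).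
  by apply: filterS => y + /[dup] Ay => /[apply]; apply; exact: AB.
move=> h /(rg _ (AB x Ax))[r rx hr]; have [s sx rs] := rf x Ax r rx.
exists s => //; apply: filterS2 (continuous_on_nbhs cf Ax hr) rs.
by move=> y hy rsy Ay /=; rewrite hy ?rsy//; exact: AB.
Qed.

Lemma regular_map_cst X Y (y : Y) : regular_ring X ->
  regular_map (fun _ : X => y).
Proof. by move=> rX; split=> [x|x h _]; [exact: cvg_cst|exact: regular_cst]. Qed.

Section Affine.
Variable n : nat.

Lemma affine_regular_near (x : affine_space k n) f : regular x f ->
  exists p q : mpoly n k, \forall y \near x,
    peval q y != 0 /\ f y = peval p y / peval q y.
Proof.
move=> [p [q [qx fpq]]]; exists p, q; apply: filterS2 fpq _ => [y fy qy|].
  by split; [exact: qy|].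
by apply: open_nbhs_nbhs; split; [exact: zariski_basic_open|].
Qed.

Lemma affine_regular_ring : regular_ring (affine_space k n).
Proof.
have mk (x : affine_space k n) f p q : (\forall y \near x,
    peval q y != 0 /\ f y = peval p y / peval q y) -> regular x f.
  move=> pq; exists p, q; split; first by case: (nbhs_singleton pq).
  by apply: filterS pq => y [].
split=> [x c|x f g|x f g|x f|x f].
- apply: (mk x _ (mpolyC n c) 1); apply: (@near_all (affine_space k n)) => y.
  by rewrite pevalC /peval meval1 divr1 oner_eq0.
- move=> /affine_regular_near[p [q pq]] /affine_regular_near[p' [q' pq']].
  apply: (mk x _ (p * q' + p' * q) (q * q')).
  apply: filterS2 pq pq' => y [qy ->] [qy' ->].
  by rewrite pevalD !pevalM mulf_neq0// addf_div.
- move=> /affine_regular_near[p [q pq]] /affine_regular_near[p' [q' pq']].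
  apply: (mk x _ (p * p') (q * q')).
  apply: filterS2 pq pq' => y [qy ->] [qy' ->].
  by rewrite !pevalM mulf_neq0// mulf_div.
- move=> /affine_regular_near[p [q pq]] fx; apply: (mk x _ q p).
  have px : peval p x != 0.
    move: fx; have [_ ->] := nbhs_singleton pq.
    by rewrite mulf_eq0 negb_or => /andP[].
  apply: filterS2 pq _ => [y [qy ->] py|]; first by rewrite invf_div; split; [exact: py|].
  by apply: open_nbhs_nbhs; split; [exact: zariski_basic_open|].
- move=> /affine_regular_near[p [q pq]] fx.
  have px : peval p x != 0.
    move: fx; have [_ ->] := nbhs_singleton pq.
    by rewrite mulf_eq0 negb_or => /andP[].
  apply: filterS2 pq _ => [y [qy ->] py|]; first by rewrite mulf_neq0 ?invr_eq0//; exact: py.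
  by apply: open_nbhs_nbhs; split; [exact: zariski_basic_open|].
Qed.

Lemma affine_regular_coord (x : affine_space k n) (i : 'I_n) :
  regular x (fun y : affine_space k n => (y : 'rV[k]_n) ord0 i).
Proof.
exists (mpolyX k (mnm1 i)), 1; split; first by rewrite /peval meval1 oner_eq0.
by apply: (@near_all (affine_space k n)) => y; rewrite pevalX /peval meval1 divr1.
Qed.

Lemma regular_peval X (A : set X) (f : X -> affine_space k n) (p : mpoly n k) x :
  regular_ring X -> A x ->
  (forall i, exists2 r : X -> k, regular x r &
     \forall y \near x, A y -> (f y : 'rV[k]_n) ord0 i = r y) ->
  exists2 r : X -> k, regular x r & \forall y \near x, A y -> peval p (f y) = r y.
Proof.
move=> rX Ax fr; have [r rP] : {r : 'I_n -> X -> k & forall i, regular x (r i) /\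
    \forall y \near x, A y -> (f y : 'rV[k]_n) ord0 i = r i y}.
  apply: (@choice _ _ (fun i r => regular x r /\
    \forall y \near x, A y -> (f y : 'rV[k]_n) ord0 i = r y)) => i.
  by have [r] := fr i; exists r.
exists (fun y => meval (r ^~ y) p).
  under eq_fun do rewrite mevalE.
  apply: regular_sum => // m; apply: regularM => //; first exact: regular_cst.
  by apply: regular_prod => // i; apply: regularX => //; case: (rP i).
have : \forall y \near x, forall i, A y -> (f y : 'rV[k]_n) ord0 i = r i y.
  by apply: filter_forall => i; case: (rP i).
by apply: filterS => y ry Ay; apply: meval_eq => i; exact: ry.
Qed.

(** Coordinates decide, because nonvanishing loci of polynomials form a basis of open sets and
    regular functions are local quotients of polynomials. *)
Lemma regular_map_on_affine X (A : set X) (f : X -> affine_space k n) :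
  regular_ring X ->
  (forall x, A x -> forall i, exists2 r : X -> k, regular x r &
     \forall y \near x, A y -> (f y : 'rV[k]_n) ord0 i = r y) ->
  regular_map_on A f.
Proof.
move=> rX fr; split=> x Ax.
  move=> V oV Vx; have [q qx qV] := zariski_basicP oV Vx.
  have [r rx rq] := regular_peval q rX Ax (fr x Ax).
  have rx0 : r x != 0 by rewrite -(nbhs_singleton rq Ax).
  apply: filterS2 (regular_neq0 rX rx rx0) rq => y ry qy Ay.
  by apply: qV; rewrite qy.
move=> h [p [q [qx hpq]]].
have [r rx rp] := regular_peval p rX Ax (fr x Ax).
have [s sx sq] := regular_peval q rX Ax (fr x Ax).
have sx0 : s x != 0 by rewrite -(nbhs_singleton sq Ax).
exists (fun y => r y * (s y)^-1).
  by apply: regularM => //; exact: regularV.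
have [V [oV Vx] Vpq] := nbhs_open hpq.
have [t tx tV] := zariski_basicP oV Vx.
have [u ux ut] := regular_peval t rX Ax (fr x Ax).
have ux0 : u x != 0 by rewrite -(nbhs_singleton ut Ax).
have near2 : \forall y \near x, u y != 0 /\ (A y -> peval t (f y) = u y).
  by apply: filterS2 (regular_neq0 rX ux ux0) ut.
apply: filterS3 rp sq near2 => y rpy sqy [uy uty] Ay.
rewrite -rpy// -sqy//; apply: (Vpq (f y)); apply: tV.
by rewrite uty.
Qed.

End Affine.

End RegularMaps.

(** * Products *)

Section Tensors.
Context {k : fieldType} (X Y : fspace k).
Implicit Types (U : set X) (V : set Y) (z : prod_space X Y).

Lemma tensor_on_fin U V (I : finType) (a : I -> X -> k) (b : I -> Y -> k) h :
  (forall i, regular_on U (a i)) -> (forall i, regular_on V (b i)) ->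
  (forall z : prod_carrier X Y, h z = \sum_i a i z.1 * b i z.2) ->
  tensor_on U V h.
Proof.
move=> ra rb hE; exists #|I|, (a \o enum_val), (b \o enum_val).
split=> [i|i|z]; [exact: ra|exact: rb|].
by rewrite hE (reindex _ (onW_bij _ (enum_val_bij I))).
Qed.

Lemma tensor_on1 U V (a : X -> k) (b : Y -> k) :
  regular_on U a -> regular_on V b ->
  tensor_on U V (fun z : prod_carrier X Y => a z.1 * b z.2).
Proof.
move=> ra rb; apply: (@tensor_on_fin U V unit (fun=> a) (fun=> b)) => // z.
by rewrite (big_pred1 tt) // => -[].
Qed.

Lemma tensor_onS U U' V V' h : U' `<=` U -> V' `<=` V ->
  tensor_on U V h -> tensor_on U' V' h.
Proof.
move=> UU VV [n [a [b [ra rb hE]]]]; exists n, a, b; split=> // i x.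
  by move=> /UU; exact: ra.
by move=> /VV; exact: rb.
Qed.

Lemma tensor_onD U V h h' : tensor_on U V h -> tensor_on U V h' ->
  tensor_on U V (fun z => h z + h' z).
Proof.
move=> [n [a [b [ra rb hE]]]] [n' [a' [b' [ra' rb' hE']]]].
apply: (@tensor_on_fin U V ('I_n + 'I_n')%type
  (fun i => match i with inl i => a i | inr i => a' i end)
  (fun i => match i with inl i => b i | inr i => b' i end)).
- by case.
- by case.
- by move=> z; rewrite big_sumType hE hE'.
Qed.

Context (rX : regular_ring X) (rY : regular_ring Y).

Lemma tensor_onM U V h h' : tensor_on U V h -> tensor_on U V h' ->
  tensor_on U V (fun z => h z * h' z).
Proof.
move=> [n [a [b [ra rb hE]]]] [n' [a' [b' [ra' rb' hE']]]].
apply: (@tensor_on_fin U V ('I_n * 'I_n')%type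
  (fun i x => a i.1 x * a' i.2 x) (fun i y => b i.1 y * b' i.2 y)).
- by move=> i x Ux; apply: regularM => //; [exact: ra|exact: ra'].
- by move=> i y Vy; apply: regularM => //; [exact: rb|exact: rb'].
- move=> z; rewrite hE hE' big_distrlr pair_bigA /=.
  by apply: eq_bigr => i _; rewrite mulrACA.
Qed.

Lemma prod_open_rect U V : open U -> open V ->
  open [set z : prod_space X Y | U z.1 /\ V z.2].
Proof.
move=> oU oV; apply: prod_basic_open; exists U, V, (fun=> 1 * 1); split=> //.
  by apply: (@tensor_on1 _ _ (fun=> 1) (fun=> 1)) => x _; exact: regular_cst.
by apply/seteqP; split=> z /=; rewrite mul1r => -[//]; split=> //; exact: oner_neq0.
Qed.

Lemma tensor_on_neq0 U V h z : open U -> open V -> U z.1 -> V z.2 ->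
  tensor_on U V h -> h z != 0 -> \forall w \near z, h w != 0.
Proof.
move=> oU oV Uz Vz th hz.
have : nbhs z ((U `*` V) `&` [set w | h w != 0]).
  by apply: open_nbhs_nbhs; split=> //; apply: prod_basic_open; exists U, V, h.
by apply: filterS => w [].
Qed.

Lemma prod_regular_ring : regular_ring (prod_space X Y).
Proof.
have near_frac z (f : prod_space X Y -> k) : regular z f -> exists U V g h,
  [/\ [/\ open U, open V, U z.1 & V z.2], tensor_on U V g, tensor_on U V h &
     \forall w \near z, h w != 0 /\ f w = g w / h w].
  move=> [U [V [g [h [[oU oV [Uz Vz]] tg th hz fE]]]]].
  exists U, V, g, h; split=> //.
  by apply: filterS2 (tensor_on_neq0 oU oV Uz Vz th hz) fE => w hw fw.
have mk z (f : prod_space X Y -> k) U V g h : open U -> open V -> U z.1 -> V z.2 ->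
    tensor_on U V g -> tensor_on U V h ->
    (\forall w \near z, h w != 0 /\ f w = g w / h w) -> regular z f.
  move=> oU oV Uz Vz tg th fE; exists U, V, g, h; split=> //.
    by case: (nbhs_singleton fE).
  by apply: filterS fE => w [].
have frac2 z (f f' : prod_space X Y -> k) : regular z f -> regular z f' ->
  exists U V g h g' h', [/\ [/\ open U, open V, U z.1 & V z.2],
    tensor_on U V g /\ tensor_on U V h, tensor_on U V g' /\ tensor_on U V h',
    \forall w \near z, h w != 0 /\ f w = g w / h w &
    \forall w \near z, h' w != 0 /\ f' w = g' w / h' w].
  move=> /near_frac[U [V [g [h [[oU oV Uz Vz] tg th fE]]]]].
  move=> /near_frac[U' [V' [g' [h' [[oU' oV' Uz' Vz'] tg' th' fE']]]]].
  exists (U `&` U'), (V `&` V'), g, h, g', h'; split=> //.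
  - by split; [exact: openI|exact: openI| |].
  - by split; [apply: tensor_onS tg|apply: tensor_onS th] => x [].
  - by split; [apply: tensor_onS tg'|apply: tensor_onS th'] => x [].
split=> [z c|z f f'|z f f'|z f|z f].
- have t1 c' : tensor_on [set: X] [set: Y] (fun=> c' * 1).
    by apply: (@tensor_on1 _ _ (fun=> c') (fun=> 1)) => x _; exact: regular_cst.
  apply: (mk z _ _ _ _ _ _ _ _ _ (t1 c) (t1 1)) => //; try exact: openT.
  by apply: near_all => w; rewrite !mulr1 divr1 oner_neq0.
- move=> /frac2 /[apply] -[U [V [g [h [g' [h' [[oU oV Uz Vz] [tg th] [tg' th'] fE fE']]]]]]].
  apply: (mk z _ _ _ _ _ oU oV Uz Vz
    (tensor_onD (tensor_onM tg th') (tensor_onM tg' th)) (tensor_onM th th')).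
  by apply: filterS2 fE fE' => w [hw ->] [hw' ->]; rewrite mulf_neq0// addf_div.
- move=> /frac2 /[apply] -[U [V [g [h [g' [h' [[oU oV Uz Vz] [tg th] [tg' th'] fE fE']]]]]]].
  apply: (mk z _ _ _ _ _ oU oV Uz Vz (tensor_onM tg tg') (tensor_onM th th')).
  by apply: filterS2 fE fE' => w [hw ->] [hw' ->]; rewrite mulf_neq0// mulf_div.
- move=> /near_frac[U [V [g [h [[oU oV Uz Vz] tg th fE]]]]] fz.
  have gz : g z != 0.
    by move: fz; have [_ ->] := nbhs_singleton fE; rewrite mulf_eq0 negb_or => /andP[].
  apply: (mk z _ _ _ _ _ oU oV Uz Vz th tg).
  apply: filterS2 fE (tensor_on_neq0 oU oV Uz Vz tg gz) => w [hw ->] gw.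
  by rewrite invf_div.
- move=> /near_frac[U [V [g [h [[oU oV Uz Vz] tg th fE]]]]] fz.
  have gz : g z != 0.
    by move: fz; have [_ ->] := nbhs_singleton fE; rewrite mulf_eq0 negb_or => /andP[].
  apply: filterS2 fE (tensor_on_neq0 oU oV Uz Vz tg gz) => w [hw ->] gw.
  by rewrite mulf_neq0 ?invr_eq0.
Qed.

Lemma regular_map_fst : @regular_map k (prod_space X Y) X fst.
Proof.
apply/regular_map_onT; split=> [z _ U oU Uz|z _ h].
  have : nbhs z [set w : prod_space X Y | U w.1 /\ [set: Y] w.2].
    by apply: open_nbhs_nbhs; split=> //; apply: prod_open_rect => //; exact: openT.
  by apply: filterS => w [].
move=> /regular_open /nbhs_open[U [oU Uz] Uh]; exists (h \o fst) => //; last exact: near_all.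
have t a : regular_on U a -> tensor_on U [set: Y] (fun z => a z.1 * 1).
  by move=> ra; apply: (@tensor_on1 _ _ a (fun=> 1)) => // y _; exact: regular_cst.
exists U, setT, (fun z => h z.1 * 1), (fun z => 1 * 1); split.
- by split=> //; exact: openT.
- exact: t.
- by apply: (t (fun=> 1)) => x _; exact: regular_cst.
- by rewrite mulr1 oner_neq0.
- by apply: near_all => w; rewrite !mulr1 divr1.
Qed.

Lemma regular_map_snd : @regular_map k (prod_space X Y) Y snd.
Proof.
apply/regular_map_onT; split=> [z _ V oV Vz|z _ h].
  have : nbhs z [set w : prod_space X Y | [set: X] w.1 /\ V w.2].
    by apply: open_nbhs_nbhs; split=> //; apply: prod_open_rect => //; exact: openT.
  by apply: filterS => w [].
move=> /regular_open /nbhs_open[V [oV Vz] Vh]; exists (h \o snd) => //; last exact: near_all.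
have t b : regular_on V b -> tensor_on [set: X] V (fun z => 1 * b z.2).
  by move=> rb; apply: (@tensor_on1 _ _ (fun=> 1) b) => // y _; exact: regular_cst.
exists setT, V, (fun z => 1 * h z.2), (fun z => 1 * 1); split.
- by split=> //; exact: openT.
- exact: t.
- by apply: (t (fun=> 1)) => x _; exact: regular_cst.
- by rewrite mulr1 oner_neq0.
- by apply: near_all => w; rewrite !mul1r divr1.
Qed.

Lemma prod_open_subbase (W : set (prod_space X Y)) z : open W -> W z ->
  exists s : seq (set (prod_carrier X Y)),
    (forall B, B \in s -> prod_basic B /\ B z) /\
    (forall w, (forall B, B \in s -> B w) -> W w).
Proof.
move=> oW Wz; have [D' D'f WE] := oW.
move: Wz; rewrite -WE => -[B D'B Bz]; have [D Db DB] := D'f B D'B.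
exists (enum_fset D); split=> [A AD|w Dw].
  split; first by have := Db A AD; rewrite inE.
  by have : B z := Bz; rewrite -DB; apply.
have Bw : B w by rewrite -DB => A AD; exact: Dw.
by exists B.
Qed.

(** The topology of [prod_space] is finer than the product topology, so even continuity requires
    that tensors pull back to regular functions; this is [tensorP]. *)
Lemma regular_map_on_pair (W : fspace k) (A : set W) (f : W -> X) (g : W -> Y) :
  regular_ring W -> regular_map_on A f -> regular_map_on A g ->
  regular_map_on A (fun w => (f w, g w) : prod_space X Y).
Proof.
move=> rW [cf rf] [cg rg].
have tensorP U V h w : A w -> U (f w) -> V (g w) -> tensor_on U V h ->
    exists2 r : W -> k, regular w r & \forall v \near w, A v -> h (f v, g v) = r v.
  move=> Aw Uw Vw [n [a [b [ra rb hE]]]].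
  have [r rP] : {r : 'I_n -> W -> k & forall i, regular w (r i) /\
      \forall v \near w, A v -> a i (f v) = r i v}.
    apply: (@choice _ _ (fun i r => regular w r /\
      \forall v \near w, A v -> a i (f v) = r v)) => i.
    by have [r] := rf w Aw (a i) (ra i _ Uw); exists r.
  have [s sP] : {s : 'I_n -> W -> k & forall i, regular w (s i) /\
      \forall v \near w, A v -> b i (g v) = s i v}.
    apply: (@choice _ _ (fun i s => regular w s /\
      \forall v \near w, A v -> b i (g v) = s v)) => i.
    by have [s] := rg w Aw (b i) (rb i _ Vw); exists s.
  exists (fun v => \sum_i r i v * s i v).
    apply: regular_sum => // i.
    by apply: regularM => //; [case: (rP i)|case: (sP i)].
  have rn : \forall v \near w, forall i, A v -> a i (f v) = r i v.
    by apply: filter_forall => i; case: (rP i).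
  have sn : \forall v \near w, forall i, A v -> b i (g v) = s i v.
    by apply: filter_forall => i; case: (sP i).
  apply: filterS2 rn sn => v rv sv Av; rewrite hE; apply: eq_bigr => i _.
  by rewrite rv// sv.
have cont : continuous_on A (fun w => (f w, g w) : prod_space X Y).
  move=> w Aw V oV /(prod_open_subbase oV)[s [sb sV]].
  suff : \forall v \near w, forall B, B \in s -> A v -> B (f v, g v).
    by apply: filterS => v sv Av; apply: sV => B Bs; exact: sv.
  elim: s sb {sV} => [|B s IH] sb; first exact: near_all.
  have [|[U [V' [h [oU oV' th BE]]]] Bw] := sb B; first exact: mem_head.
  move: Bw; rewrite BE => -[[Uw Vw] hw].
  have [r rw hr] := tensorP U V' h w Aw Uw Vw th.
  have rw0 : r w != 0 by rewrite -(nbhs_singleton hr Aw).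
  have nearUV : \forall v \near w, A v -> U (f v) /\ V' (g v).
    apply: filterS2 (cf w Aw U oU Uw) (cg w Aw V' oV' Vw) => v Uv Vv Av.
    by split; [exact: Uv|exact: Vv].
  have nearh : \forall v \near w, A v -> h (f v, g v) != 0.
    by apply: filterS2 hr (regular_neq0 rW rw rw0) => v hv rv /hv ->.
  have nears : \forall v \near w, forall B, B \in s -> A v -> B (f v, g v).
    by apply: IH => B' B's; apply: sb; rewrite inE B's orbT.
  apply: filterS3 nearUV nearh nears => v UVv hv sv B'.
  rewrite inE => /predU1P[->|]; last exact: sv.
  by move=> Av; split; [exact: UVv|exact: hv].
split=> // w Aw h [U [V [p [q [[oU oV [Uw Vw]] tp tq qw hpq]]]]].
have [r rw pr] := tensorP U V p w Aw Uw Vw tp.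
have [s sw qs] := tensorP U V q w Aw Uw Vw tq.
have sw0 : s w != 0 by rewrite -(nbhs_singleton qs Aw).
exists (fun v => r v * (s v)^-1); first by apply: regularM => //; exact: regularV.
apply: filterS3 pr qs (continuous_on_nbhs cont Aw hpq) => v pv qv hv Av.
by rewrite hv// pv// qv.
Qed.

End Tensors.

(** * Varieties *)

Section Charts.
Context {k : fieldType}.
Implicit Types X Y : fspace k.

Lemma nbhs_induced X (A : set X) (v : A) (W : set A) :
  nbhs (v : induced_space A) W <->
  \forall y \near set_val v, forall p : y \in A, W (exist _ y p).
Proof.
split=> [/nbhs_open[_ [[O oO <-] Ov] OW]|].
  have : nbhs (set_val v) O by apply: open_nbhs_nbhs.
  by apply: filterS => y Oy p; exact: (OW (exist _ y p)).
move=> /(@initial_continuous A X set_val v); rewrite nbhs_simpl /=.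
by apply: filterS => -[y p]; exact.
Qed.

(** Bridge between the subtypes in the definition of a prevariety and total functions restricted to
    subsets. *)
Lemma regular_map_induced X Y (V : set X) (B : set Y)
    (f : induced_space V -> induced_space B) (c : X -> Y) :
  (forall v : V, c (set_val v) = set_val (f v)) ->
  regular_map f <-> regular_map_on V c.
Proof.
move=> cf.
have cfE y (p : y \in V) : c y = set_val (f (exist _ y p)) by rewrite -cf.
split=> [[cof rf]|[cc rc]].
  split=> x Vx; pose v : V := exist _ x (mem_set Vx).
    move=> O oO Ox; have fO : nbhs (f v) [set w | O (set_val w)].
      by apply: open_nbhs_nbhs; split; [exists O|rewrite /= -cf].
    have /nbhs_induced : nbhs (v : induced_space V) (f @^-1` [set w | O (set_val w)]).
      exact: cof v _ fO.
    by apply: filterS => y fy Vy; rewrite (cfE y (mem_set Vy)); exact: fy.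
  move=> h hx; have [|g gx /nbhs_induced hg] := rf v (h \o set_val).
    by exists h; [rewrite -cf|exact: near_all].
  exists g => //; apply: filterS hg => y hg Vy.
  by rewrite (cfE y (mem_set Vy)); exact: hg.
have cof v W : nbhs (f v) W -> nbhs v (f @^-1` W).
  move=> /nbhs_induced fW; apply/nbhs_induced.
  have : nbhs (c (set_val v)) (fun y => forall p : y \in B, W (exist _ y p)).
    by rewrite cf.
  move=> /(continuous_on_nbhs cc (set_valP v)); apply: filterS => y Wy p.
  have := Wy (set_mem p); rewrite (cfE y p) => /(_ (valP (f (exist _ y p)))).
  by congr W; apply: val_inj.
split=> [v W /cof //|v h [g gv hg]].
have gc : regular (c (set_val v)) g by rewrite cf.
have [r rv gr] := rc _ (set_valP v) g gc.
exists r => //; have hr : nbhs v [set w | g (c (set_val w)) = r (set_val w)].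
  by apply/nbhs_induced; apply: filterS gr => y + p; apply; exact: set_mem.
by apply: filterS2 (cof v _ hg) hr => w /= -> <-; rewrite cf.
Qed.

Record chart X (V : set X) n (B : set (affine_space k n))
    (c : X -> affine_space k n) (d : affine_space k n -> X) : Prop := Chart {
  chart_open : open V;
  chart_locally_closed : locally_closed B;
  chart_maps : forall x, V x -> B (c x);
  chart_invmaps : forall b, B b -> V (d b);
  chartK : forall x, V x -> d (c x) = x;
  chart_invK : forall b, B b -> c (d b) = b;
  chart_regular : regular_map_on V c;
  chart_inv_regular : regular_map_on B d }.

Lemma isomorphic_chart X (x0 : X) (V : set X) n (B : set (affine_space k n)) :
  open V -> locally_closed B -> isomorphic (induced_space V) (induced_space B) ->
  exists c d, chart V B c d.
Proof.
move=> oV lB [f [g [fK gK rf rg]]].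
(* The values 0 off [V] and [x0] off [B] are mere defaults. *)
pose c x : affine_space k n :=
  if pselect (x \in V) is left p then set_val (f (exist _ x p)) else (0 : 'rV[k]_n).
pose d b : X :=
  if pselect (b \in B) is left p then set_val (g (exist _ b p)) else x0.
have cE (v : V) : c (set_val v) = set_val (f v).
  rewrite /c; case: pselect => [p|/(_ (valP v))//]; congr (set_val (f _)).
  exact: val_inj.
have dE (b : B) : d (set_val b) = set_val (g b).
  rewrite /d; case: pselect => [p|/(_ (valP b))//]; congr (set_val (g _)).
  exact: val_inj.
exists c, d; split=> //.
- by move=> x Vx; rewrite (cE (exist _ x (mem_set Vx))); exact: set_valP.
- by move=> b Bb; rewrite (dE (exist _ b (mem_set Bb))); exact: set_valP.
- by move=> x Vx; rewrite (cE (exist _ x (mem_set Vx))) dE fK.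
- by move=> b Bb; rewrite (dE (exist _ b (mem_set Bb))) cE gK.
- exact/(regular_map_induced cE).
- exact/(regular_map_induced dE).
Qed.

Lemma chart_isomorphic X (V : set X) n (B : set (affine_space k n)) c d :
  chart V B c d -> isomorphic (induced_space V) (induced_space B).
Proof.
case=> oV lB cB dV cK dK rc rd.
pose f (v : V) : B := exist _ (c (set_val v)) (mem_set (cB _ (set_valP v))).
pose g (b : B) : V := exist _ (d (set_val b)) (mem_set (dV _ (set_valP b))).
exists f, g; split.
- by move=> v; apply: val_inj; rewrite /= cK//; exact: set_valP.
- by move=> b; apply: val_inj; rewrite /= dK//; exact: set_valP.
- by apply/(@regular_map_induced _ _ _ _ _ c).
- by apply/(@regular_map_induced _ _ _ _ _ d).
Qed.

Lemma prevariety_chart X (x : X) : prevariety X ->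
  exists (m : nat) (V : 'I_m -> set X), \bigcup_i V i = setT /\
    forall i, exists n (B : set (affine_space k n)) c d, chart (V i) B c d.
Proof.
move=> [m [V [oV VT cV]]]; exists m, V; split=> // i.
have [n [B [lB iso]]] := cV i; exists n, B.
exact: isomorphic_chart iso.
Qed.

Lemma prevariety_chart_at X (x : X) : prevariety X ->
  exists V n (B : set (affine_space k n)) c d, V x /\ chart V B c d.
Proof.
move=> /(prevariety_chart x)[m [V [VT cV]]].
have [i _ Vx] : (\bigcup_i V i) x by rewrite VT.
by have [n [B [c [d cd]]]] := cV i; exists (V i), n, B, c, d.
Qed.

Lemma prevariety_regular_ring X : prevariety X -> regular_ring X.
Proof.
move=> pX; have rA n := @affine_regular_ring k n.
(* [down] expresses a regular germ in a chart and [up] carries one back, so each operation is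
   performed in affine space. *)
have down (x : X) f : regular x f -> forall V n (B : set (affine_space k n)) c d,
    V x -> chart V B c d -> exists2 r : affine_space k n -> k,
    regular (c x) r & \forall y \near x, f y = r (c y).
  move=> fx V n B c d Vx cd; have [oV lB cB dV cK dK [cc rc] rd] := cd.
  have fdc : regular (d (c x)) f by rewrite cK.
  have [r rx fr] := rd.2 _ (cB x Vx) f fdc; exists r => //.
  have nV : nbhs x V by apply: open_nbhs_nbhs.
  apply: filterS2 (continuous_on_nbhs cc Vx fr) nV => y fy Vy.
  by rewrite -(fy Vy (cB _ Vy)) cK.
have up (x : X) f V n (B : set (affine_space k n)) c d r : V x -> chart V B c d ->
    regular (c x) r -> (\forall y \near x, f y = r (c y)) -> regular x f.
  move=> Vx cd rx fr; have [oV lB cB dV cK dK [cc rc] rd] := cd.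
  have [s sx rs] := rc x Vx r rx; apply: regular_local sx.
  have nV : nbhs x V by apply: open_nbhs_nbhs.
  by apply: filterS3 fr rs nV => y fy rsy Vy; rewrite fy rsy.
split=> [x a|x f g fx gx|x f g fx gx|x f fx f0|x f fx f0];
  have [V [n [B [c [d [Vx cd]]]]]] := prevariety_chart_at x pX.
- by apply: (up x _ _ _ _ _ _ (fun=> a) Vx cd (regular_cst (rA n) _ a)); exact: near_all.
- have [r rx fr] := down x f fx _ _ _ _ _ Vx cd.
  have [s sx gs] := down x g gx _ _ _ _ _ Vx cd.
  apply: (up x _ _ _ _ _ _ _ Vx cd (regularD (rA n) rx sx)).
  by apply: filterS2 fr gs => y -> ->.
- have [r rx fr] := down x f fx _ _ _ _ _ Vx cd.
  have [s sx gs] := down x g gx _ _ _ _ _ Vx cd.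
  apply: (up x _ _ _ _ _ _ _ Vx cd (regularM (rA n) rx sx)).
  by apply: filterS2 fr gs => y -> ->.
- have [r rx fr] := down x f fx _ _ _ _ _ Vx cd.
  have r0 : r (c x) != 0 by rewrite -(nbhs_singleton fr).
  apply: (up x _ _ _ _ _ _ _ Vx cd (regularV (rA n) rx r0)).
  by apply: filterS fr => y ->.
- have [r rx fr] := down x f fx _ _ _ _ _ Vx cd.
  have r0 : r (c x) != 0 by rewrite -(nbhs_singleton fr).
  have [cc _] := chart_regular cd.
  have nV : nbhs x V by apply: open_nbhs_nbhs; split=> //; exact: chart_open cd.
  have := continuous_on_nbhs cc Vx (regular_neq0 (rA n) rx r0).
  by move=> nr; apply: filterS3 fr nr nV => y -> ry /ry.
Qed.

End Charts.

(** * Products of varieties *)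

Section ProductVariety.
Context {k : fieldType}.
Implicit Types X Y : fspace k.

Lemma regular_map_pair X Y (W : fspace k) (f : W -> X) (g : W -> Y) :
  regular_ring W -> regular_map f -> regular_map g ->
  regular_map (fun w => (f w, g w) : prod_space X Y).
Proof.
move=> rW /regular_map_onT rf /regular_map_onT rg.
by apply/regular_map_onT; exact: regular_map_on_pair.
Qed.

(** Slices over points of [A] are copies of [B], so each lies in [P] or in [Q]. The points whose
    slice lies in a given closed set form the closed set [part], and irreducibility of [A] selects
    one of the two. *)
Lemma irreducible_set_prod X Y (A : set X) (B : set Y) :
  regular_ring X -> regular_ring Y -> irreducible_set A -> irreducible_set B ->
  irreducible_set [set z : prod_space X Y | A z.1 /\ B z.2].
Proof.
move=> rX rY [[x Ax] irrA] [[y By] irrB]; split; first by exists (x, y).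
have slice1 (y' : Y) : continuous (fun x' : X => (x', y') : prod_space X Y).
  by have [] := regular_map_pair rX (@regular_map_id _ X) (regular_map_cst y' rX).
have slice2 (x' : X) : continuous (fun y' : Y => (x', y') : prod_space X Y).
  by have [] := regular_map_pair rY (regular_map_cst x' rY) (@regular_map_id _ Y).
move=> P Q cP cQ APQ.
pose part (R : set (prod_space X Y)) := [set x' : X | forall y', B y' -> R (x', y')].
have cpart R : closed R -> closed (part R).
  move=> cR; rewrite (_ : part R = \bigcap_(y' in B) ((fun x' : X => (x', y') : prod_space X Y) @^-1` R)).
    by apply: closed_bigI => y' _; move/continuous_closedP: (slice1 y'); exact.
  by apply/seteqP; split.
have [||x' Ax'|AP|AQ] := irrA (part P) (part Q); [exact: cpart|exact: cpart|..].
- have pre R : closed R -> closed ((fun y' : Y => (x', y') : prod_space X Y) @^-1` R).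
    by move=> cR; move/continuous_closedP: (slice2 x'); exact.
  have [y' By'|BP|BQ] := irrB _ _ (pre P cP) (pre Q cQ).
  + by apply: APQ.
  + by left=> y' /BP.
  + by right=> y' /BQ.
- by left=> -[x' y'] [/= /AP]; apply.
- by right=> -[x' y'] [/= /AQ]; apply.
Qed.

Lemma chart_prod X Y (V : set X) (V' : set Y) n n' (B : set (affine_space k n))
    (B' : set (affine_space k n')) c d c' d' :
  regular_ring X -> regular_ring Y -> chart V B c d -> chart V' B' c' d' ->
  exists (B2 : set (affine_space k (n + n'))) c2 d2,
    chart [set z : prod_space X Y | V z.1 /\ V' z.2] B2 c2 d2.
Proof.
move=> rX rY [oV [U [C [oU cC BE]]] cB dV cK dK rc rd].
move=> [oV' [U' [C' [oU' cC' BE']]] cB' dV' cK' dK' rc' rd'].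
have rA := @affine_regular_ring k (n + n').
pose l (x : affine_space k (n + n')) : affine_space k n := lsubmx (x : 'rV[k]_(n + n')).
pose r (x : affine_space k (n + n')) : affine_space k n' := rsubmx (x : 'rV[k]_(n + n')).
have rl : regular_map l.
  apply/regular_map_onT/regular_map_on_affine => // x _ i.
  exists (fun y => (y : 'rV[k]_(n + n')) ord0 (lshift n' i)).
    exact: affine_regular_coord.
  by apply: near_all => y _; rewrite mxE.
have rr : regular_map r.
  apply/regular_map_onT/regular_map_on_affine => // x _ i.
  exists (fun y => (y : 'rV[k]_(n + n')) ord0 (rshift n i)).
    exact: affine_regular_coord.
  by apply: near_all => y _; rewrite mxE.
have prerl O : open O -> open (l @^-1` O) by move=> oO; case: rl => /continuousP + _; exact.
have prerr O : open O -> open (r @^-1` O) by move=> oO; case: rr => /continuousP + _; exact.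
have precl D : closed D -> closed (l @^-1` D) by move=> cD; case: rl => /continuous_closedP + _; exact.
have precr D : closed D -> closed (r @^-1` D) by move=> cD; case: rr => /continuous_closedP + _; exact.
exists [set x | B (l x) /\ B' (r x)].
exists (fun z => row_mx (c z.1 : 'rV[k]_n) (c' z.2 : 'rV[k]_n')).
exists (fun x => (d (l x), d' (r x))); split.
- exact: prod_open_rect.
- exists (l @^-1` U `&` r @^-1` U'), (l @^-1` C `&` r @^-1` C'); split.
  + by apply: openI; [exact: prerl|exact: prerr].
  + by apply: closedI; [exact: precl|exact: precr].
  + rewrite BE BE'; apply/seteqP; split=> x /=.
      by move=> [[? ?] [? ?]].
    by move=> [[? ?] [? ?]].
- move=> [x y] [/= Vx Vy]; rewrite /l /r row_mxKl row_mxKr.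
  by split; [exact: cB|exact: cB'].
- by move=> x [Bx Bx']; split; [exact: dV|exact: dV'].
- move=> [x y] [/= Vx Vy]; rewrite /l /r row_mxKl row_mxKr.
  by rewrite cK// cK'.
- by move=> x [Bx Bx'] /=; rewrite dK// dK'// hsubmxK.
- apply: regular_map_on_affine; first exact: prod_regular_ring.
  move=> z [Vz Vz'] i; case: (splitP i) => j ij.
    have -> : i = lshift n' j by apply: val_inj.
    have [cf rf] := regular_map_on_comp
      (regular_map_onS (@subsetT _ _) (iffRL (regular_map_onT _) (regular_map_fst rX rY)))
      rc (fun (z : prod_space X Y) (Vz : V z.1 /\ V' z.2) => Vz.1).
    have [s sz sP] := rf z (conj Vz Vz') _ (affine_regular_coord (c z.1) j).
    exists s => //; apply: filterS sP => w + Vw => /(_ Vw) <-.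
    by rewrite row_mxEl.
  have -> : i = rshift n j by apply: val_inj.
  have [cf rf] := regular_map_on_comp
    (regular_map_onS (@subsetT _ _) (iffRL (regular_map_onT _) (regular_map_snd rX rY)))
    rc' (fun (z : prod_space X Y) (Vz : V z.1 /\ V' z.2) => Vz.2).
  have [s sz sP] := rf z (conj Vz Vz') _ (affine_regular_coord (c' z.2) j).
  exists s => //; apply: filterS sP => w + Vw => /(_ Vw) <-.
  by rewrite row_mxEr.
- apply: regular_map_on_pair => //.
    apply: (regular_map_on_comp _ rd) => [|x []//].
    by apply: regular_map_onS (iffRL (regular_map_onT _) rl).
  apply: (regular_map_on_comp _ rd') => [|x []//].
  by apply: regular_map_onS (iffRL (regular_map_onT _) rr).
Qed.

Lemma prevariety_prod X Y (x0 : X) (y0 : Y) :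
  prevariety X -> prevariety Y -> prevariety (prod_space X Y).
Proof.
move=> pX pY; have rX := prevariety_regular_ring pX.
have rY := prevariety_regular_ring pY.
have [m [V [VT cV]]] := prevariety_chart x0 pX.
have [m' [V' [VT' cV']]] := prevariety_chart y0 pY.
pose I : finType := ('I_m * 'I_m')%type.
pose W (i : I) := [set z : prod_space X Y | V i.1 z.1 /\ V' i.2 z.2].
exists #|I|, (W \o enum_val).
have cW i : exists n (B : set (affine_space k n)) c d, chart (W i) B c d.
  have [n [B [c [d cd]]]] := cV i.1; have [n' [B' [c' [d' cd']]]] := cV' i.2.
  by have [B2 [c2 [d2 cd2]]] := chart_prod rX rY cd cd'; exists (n + n')%N, B2, c2, d2.
split=> [i||i].
- by have [n [B [c [d cd]]]] := cW (enum_val i); exact: chart_open cd.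
- apply/seteqP; split=> // z _.
  have [i _ Vz] : (\bigcup_i V i) z.1 by rewrite VT.
  have [j _ Vz'] : (\bigcup_i V' i) z.2 by rewrite VT'.
  by exists (enum_rank ((i, j) : I)) => //=; rewrite /W enum_rankK.
- have [n [B [c [d cd]]]] := cW (enum_val i); exists n, B; split.
    exact: chart_locally_closed cd.
  exact: chart_isomorphic cd.
Qed.

(** Supplies the argument [irr] that [product_family] demands. *)
Lemma irreducible_variety_prod X Y : irreducible_variety X ->
  irreducible_variety Y -> irreducible_variety (prod_space X Y).
Proof.
move=> [[pX dX] irrX] [[pY dY] irrY].
have rX := prevariety_regular_ring pX; have rY := prevariety_regular_ring pY.
have [[x0 _] _] := irrX; have [[y0 _] _] := irrY.
have pXY := prevariety_prod x0 y0 pX pY.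
have rXY := prod_regular_ring rX rY.
split; first split=> //.
  (* The diagonal of the product is the intersection of the preimages of the two diagonals under
     pairing of first and of second components. *)
  have r2 := prod_regular_ring rXY rXY.
  have r1 := regular_map_fst rXY rXY; have r1' := regular_map_snd rXY rXY.
  have comp (A B C : fspace k) (f : A -> B) (g : B -> C) : regular_map f ->
      regular_map g -> regular_map (g \o f).
    move=> /regular_map_onT rf /regular_map_onT rg; apply/regular_map_onT.
    exact: regular_map_on_comp rf rg _.
  have [c1 _] := regular_map_pair r2 (comp _ _ _ _ _ r1 (regular_map_fst rX rY))
    (comp _ _ _ _ _ r1' (regular_map_fst rX rY)).
  have [c2 _] := regular_map_pair r2 (comp _ _ _ _ _ r1 (regular_map_snd rX rY))
    (comp _ _ _ _ _ r1' (regular_map_snd rX rY)).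
  move/continuous_closedP: c1 => /(_ _ dX) d1.
  move/continuous_closedP: c2 => /(_ _ dY) d2.
  have := closedI d1 d2; congr closed; apply/seteqP; split=> -[[x y] [x' y']] /=.
    by rewrite /preimage /= => -[-> ->].
  by move=> [-> ->].
have [XY0 irr] := irreducible_set_prod rX rY (irreducible_setT irrX) (irreducible_setT irrY).
split=> [|P Q cP cQ PQ]; first by exists (x0, y0).
have [z _|PT|QT] := irr P Q cP cQ; first by rewrite PQ.
  by left; apply/seteqP; split=> // z _; exact: PT.
by right; apply/seteqP; split=> // z _; exact: QT.
Qed.

End ProductVariety.

(** * Chain conditions for prevarieties *)

Section PrevarietyTopology.
Context {k : fieldType}.
Implicit Types X : fspace k.

Lemma chart_continuous_on_image X (V : set X) n (B : set (affine_space k n)) c d :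
  chart V B c d -> continuous_on (c @` V) d.
Proof.
by case=> _ _ cB _ _ _ _ [+ _]; apply: continuous_onS => _ [x Vx <-]; exact: cB.
Qed.

Lemma prevariety_noetherian X (x0 : X) : prevariety X -> noetherian_on [set: X].
Proof.
move=> /(prevariety_chart x0)[m [V [VT cV]]]; apply: (noetherian_cover VT) => i.
have [n [B [c [d cd]]]] := cV i.
apply: (@noetherian_retraction _ _ (V i) c d).
- by move=> x; rewrite inE; exact: chartK cd x.
- exact: chart_continuous_on_image cd.
- exact: affine_noetherian.
Qed.

Lemma prevariety_irreducible_acc X : prevariety X -> irreducible_acc X.
Proof.
move=> pX; apply: irreducible_acc_local => x.
have [V [n [B [c [d [Vx cd]]]]]] := prevariety_chart_at x pX.
exists (affine_space k n), V, c, d; split.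
- by split; [exact: chart_open cd| |exact: affine_irreducible_acc].
- by move=> y; rewrite inE; exact: chartK cd y.
- by case: (chart_regular cd).
- exact: chart_continuous_on_image cd.
Qed.

End PrevarietyTopology.

(** * Images of irreducible closed sets *)

Section Chevalley.
Context {k : closedFieldType}.

(** A nonempty open part of [A] is dense in it, so one may shrink to charts around one point [a] and
    its image, where [f] is given by quotients of polynomials and elimination applies. *)
Lemma image_contains_open (W Z : fspace k) (f : W -> Z) (A : set W) :
  prevariety W -> prevariety Z -> regular_map f -> closed A -> irreducible_set A ->
  exists U : set Z, [/\ open U, f @` A `&` U !=set0 &
    closure (f @` A) `&` U `<=` f @` A].
Proof.
move=> pW pZ [cf rf] cA irrA; have [[a Aa] _] := irrA.
have [V [n [B [c [d [Va cd]]]]]] := prevariety_chart_at a pW.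
have [V' [m [B' [c' [d' [Va' cd']]]]]] := prevariety_chart_at (f a) pZ.
have [oV [U [C [oU cC BE]]] cB dV cK dK [cc rc] [cid rd]] := cd.
have [oV' lB' cB' dV' cK' dK' [cc' rc'] rd'] := cd'.
have Bca := cB a Va.
have coord (i : 'I_m) : exists pq : mpoly n k * mpoly n k, \forall x \near c a,
    B x -> peval pq.2 x != 0 /\
    (c' (f (d x)) : 'rV[k]_m) ord0 i = peval pq.1 x / peval pq.2 x.
  have [r ra cr] := rc' (f a) Va' _ (affine_regular_coord (c' (f a)) i).
  have rfda : regular (d (c a)) (r \o f) by rewrite cK//; exact: rf.
  have [s sa rs] := rd (c a) Bca _ rfda.
  have [p [q pq]] := affine_regular_near sa; exists (p, q).
  have nV' : nbhs (f a) V' by apply: open_nbhs_nbhs.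
  have near_a : nbhs (d (c a)) (fun w => V' (f w) /\
      (V' (f w) -> (c' (f w) : 'rV[k]_m) ord0 i = r (f w))).
    have n1 : \forall w \near a, V' (f w) by exact: cf a _ nV'.
    have n2 : \forall w \near a, V' (f w) -> (c' (f w) : 'rV[k]_m) ord0 i = r (f w).
      exact: cf a _ cr.
    by rewrite cK//; apply: filterS2 n1 n2.
  have := continuous_on_nbhs cid Bca near_a.
  move=> near_d; apply: filterS3 near_d rs pq => x dx rsx [qx sx] Bx.
  have [Vfx /(_ Vfx) ->] := dx Bx.
  by split=> //; rewrite -sx -rsx.
have [pq pqP] := choice coord.
have near_all_i : \forall x \near c a, forall i, B x -> peval (pq i).2 x != 0 /\
    (c' (f (d x)) : 'rV[k]_m) ord0 i = peval (pq i).1 x / peval (pq i).2 x.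
  exact: (@near_forall (affine_space k n)).
have near_V' : \forall x \near c a, B x -> V' (f (d x)).
  have : nbhs (d (c a)) (f @^-1` V').
    by rewrite cK//; apply: cf; apply: open_nbhs_nbhs.
  by move/(continuous_on_nbhs cid Bca).
have near_U : nbhs (c a) U.
  by apply: open_nbhs_nbhs; split=> //; move: Bca; rewrite BE => -[].
have [O [oO Oa] OP] := nbhs_open (filterI near_all_i (filterI near_V' near_U)).
have [q qa qO] := zariski_basicP oO Oa.
(* The points of [K] with [q] nonzero are the coordinates of [A] within [V1]: they lie in [U], hence
   in [B], and [retraction_closure] returns them to [A]. *)
pose K := closure (c @` (A `&` V)) `&` C.
have clK : closed K by apply: closedI => //; exact: closed_closure.
have [s Ks] := @zero_locus_finite k n K clK.
pose V1 := [set w | V w /\ peval q (c w) != 0].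
have oV1 : open V1.
  rewrite openE => w [Vw qw].
  have nV : nbhs w V by apply: open_nbhs_nbhs.
  have := cc w Vw _ (zariski_basic_open q) qw.
  by move=> h; apply: filterS2 nV h => v Vv /(_ Vv).
have AV1 : A `&` V1 !=set0 by exists a.
pose E := c' @` (f @` (A `&` V1)).
have fV' w : V1 w -> V' (f w).
  move=> [Vw qw]; have [_ [+ _]] := OP (c w) (qO _ qw).
  by rewrite cK//; apply; exact: cB.
have irrE : irreducible_set E.
  apply: irreducible_set_image.
    by apply: (continuous_onS _ cc') => _ [w [_ V1w] <-]; exact: fV'.
  apply: irreducible_set_image; last exact: irreducible_setI.
  by apply: (@continuous_onS _ _ _ setT) => //; apply/continuous_onT.
have EE : E = [set y | exists x : affine_carrier k n,
    [/\ zero_locus [set` s] x, peval q x != 0 &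
        forall i, (y : 'rV[k]_m) ord0 i * peval (pq i).2 x = peval (pq i).1 x]].
  rewrite -Ks; apply/seteqP; split=> y.
    move=> [_ [w [Aw [Vw qw]] <-] <-]; exists (c w); split=> //.
      split; first by apply: subset_closure; exists w.
      by have := cB w Vw; rewrite BE => -[].
    have [cw _] := OP (c w) (qO _ qw) => i.
    by have [q0] := cw i (cB w Vw); rewrite cK// => ->; rewrite divfK.
  move=> [x [[clx Cx] qx yx]]; have [cx [Vx Ux]] := OP x (qO _ qx).
  have Bx : B x by rewrite BE.
  exists (f (d x)).
    exists (d x) => //; split.
      have := @retraction_closure _ _ V c d A _ (chart_continuous_on_image cd) cA (d x) (dV x Bx).
      by rewrite dK//; apply => // w; rewrite inE; exact: cK.
    by split; [exact: dV|rewrite dK].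
  apply/rowP => i; have [q0 ->] := cx i Bx.
  by rewrite -yx mulfK.
have dE : generically_decided E by rewrite EE; exact: generically_decided_image.
have [O' [oO' [y [Ey O'y]] clE]] :=
  generically_decided_dense dE (irreducible_set_closure irrE).
exists [set z | V' z /\ O' (c' z)]; split.
- rewrite openE => z [V'z O'z]; have nV : nbhs z V' by apply: open_nbhs_nbhs.
  have := cc' z V'z _ oO' O'z.
  by move=> h; apply: filterS2 nV h => v Vv /(_ Vv).
- have [_ [w [Aw V1w] <-] wy] := Ey.
  exists (f w); split; first by exists w.
  by split; [exact: fV'|rewrite wy].
move=> z [clz [V'z O'z]].
(* Replacing [A] by its dense part in [V1] does not change the closure of the image. *)
have clz1 : closure (f @` (A `&` V1)) z.
  have cfT : continuous_on setT f by apply/continuous_onT.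
  have := closureS (_ : f @` A `<=` closure (f @` (A `&` V1))) clz.
  rewrite -(proj1 (closure_id _) (@closed_closure _ _)); apply.
  move=> _ [w Aw <-]; apply: (continuous_on_image cfT) => //.
  exact: irreducible_setI_dense Aw.
have clEz : closure E (c' z).
  apply: (continuous_on_image cc') => //.
  by move=> _ [w [_ V1w] <-]; exact: fV'.
have [_ [w [Aw V1w] <-] wz] := clE _ (conj clEz O'z).
exists w => //; rewrite -(cK' (f w)) ?wz ?cK'//; exact: fV'.
Qed.

End Chevalley.

(** * Families of automorphisms *)

Section GroupsOfFamilies.
Context {k : fieldType} {X : fspace k} (I : aut_family X -> Prop).
Implicit Types (F H K : aut_family X) (g h : aut X) (S : set (aut X)).

Lemma autM g h x : (g * h)%g x = g (h x).
Proof. by []. Qed.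

Lemma autVK g : cancel g (g^-1)%g.
Proof. exact: aut_funK. Qed.

Lemma autKV g : cancel (g^-1)%g g.
Proof. exact: aut_invK. Qed.

Lemma aut_continuous g : continuous g.
Proof. by case: (aut_fun_regular g). Qed.

Lemma group_closed_generated : group_closed [in generated_group I].
Proof.
have GP g : (g \in [in generated_group I]) = (g \in generated_group I) by [].
split; first by rewrite GP; apply/mem_set => H [[H1 _] _]; exact: set_mem H1.
move=> g h; rewrite !GP => /set_mem Gg /set_mem Gh; apply/mem_set => H HI.
have [[H1 HD] _] := HI; apply: set_mem.
by apply: HD; apply/mem_set; [exact: Gg|exact: Gh].
Qed.

Lemma generated_group1 : generated_group I 1%g.
Proof. exact/set_mem/group_closed_generated.1. Qed.

Lemma generated_groupM g h :
  generated_group I g -> generated_group I h -> generated_group I (g * h)%g.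
Proof.
move=> Gg Gh; apply: set_mem.
by apply: (group_closedM group_closed_generated); exact: mem_set.
Qed.

Lemma generated_groupV g : generated_group I g -> generated_group I (g^-1)%g.
Proof.
move=> Gg; apply: set_mem.
by apply: (group_closedV group_closed_generated); exact: mem_set.
Qed.

Lemma generated_group_ind S : S 1%g ->
  (forall g h, S g -> S h -> S (g * h)%g) -> (forall g, S g -> S (g^-1)%g) ->
  (forall F, I F -> range F `<=` S) -> generated_group I `<=` S.
Proof.
move=> S1 SM SV SI; apply: smallest_sub; last by move=> g [F [/SI]]; exact.
split; first exact: mem_set.
by move=> g h /set_mem Sg /set_mem Sh; apply/mem_set/SM => //; exact: SV.
Qed.

Definition mul_set S S' : set (aut X) := [set (g * h)%g | g in S & h in S'].

(** Orbits depend only on the range of a family. Products of ranges are associative on the nose,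
    whereas two bracketings of a product of families have different parameter spaces. *)
Definition derived_set S : Prop := exists2 F, derived I F & range F = S.

Lemma derived_set_family F : I F -> derived_set (range F).
Proof. by move=> IF; exists F => //; apply: DerivedOne; exact: FamilyOf. Qed.

Lemma mul_setA S S' S'' :
  mul_set (mul_set S S') S'' = mul_set S (mul_set S' S'').
Proof.
apply/seteqP; split.
  move=> _ [_ [g Sg [h S'h <-]] [l S''l <-]]; exists g => //.
  by exists (h * l)%g; [exists h => //; exists l|rewrite mulgA].
move=> _ [g Sg [_ [h S'h [l S''l <-]] <-]].
by exists (g * h)%g; [exists g => //; exists h|exists l => //; rewrite mulgA].
Qed.

Lemma range_product F H irr :
  range (@product_family _ _ F H irr) = mul_set (range F) (range H).
Proof.
apply/seteqP; split.
  by move=> _ [[t s] _ <-]; exists (F t); [exists t|exists (H s) => //; exists s].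
by move=> _ [_ [t _ <-] [_ [s _ <-] <-]]; exists (t, s).
Qed.

(** Since [derived] only adds factors on the left, a product of two products has to be
    reassociated. *)
Lemma derived_setM S S' :
  derived_set S -> derived_set S' -> derived_set (mul_set S S').
Proof.
have irr F H := irreducible_variety_prod (param_irreducible F) (param_irreducible H).
move=> [F dF <-] [H dH <-]; elim: dF => {F} [F fF|F F' irrF fF _ [K dK rK]].
  by exists (product_family (irr F H)); [exact: DerivedCons|exact: range_product].
exists (product_family (irr F K)); first exact: DerivedCons.
by rewrite !range_product rK mul_setA.
Qed.

Definition inv_set S : set (aut X) := [set (g^-1)%g | g in S].

(** Order is reversed factor by factor; the inverse of an inverse family is replaced by the original
    family, which has the same range. *)
Lemma derived_setV S : derived_set S -> derived_set (inv_set S).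
Proof.
have one F : family_or_inverse I F -> derived_set (inv_set (range F)).
  case=> {}F IF.
    exists (inverse_family F); first by apply: DerivedOne; exact: InverseOf.
    apply/seteqP; split; first by move=> _ [t _ <-]; exists (F t) => //; exists t.
    by move=> _ [_ [t _ <-] <-]; exists t.
  exists F; first by apply: DerivedOne; exact: FamilyOf.
  apply/seteqP; split.
    by move=> _ [t _ <-]; exists (F t)^-1%g; [exists t|rewrite invgK].
  by move=> _ [_ [t _ <-] <-]; exists t => //=; rewrite invgK.
move=> [F dF <-]; elim: dF => {F} [F|F F' irrF /one dF _ dF']; first exact: one.
have := derived_setM dF' dF; congr derived_set; rewrite range_product.
apply/seteqP; split.
  move=> _ [_ [h Fh <-] [_ [g Fg <-] <-]]; exists (g * h)%g; last by rewrite invgM.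
  by exists g => //; exists h.
move=> _ [_ [g Fg [h Fh <-]] <-]; rewrite invgM.
by exists (h^-1)%g; [exists h|exists (g^-1)%g => //; exists g].
Qed.

Lemma derived_set_sub S : derived_set S -> S `<=` generated_group I.
Proof.
have one F : family_or_inverse I F -> range F `<=` generated_group I.
  case=> {}F IF _ [t _ <-].
    by apply: sub_gen_smallest; exists F; split=> //; exists t.
  by apply: generated_groupV; apply: sub_gen_smallest; exists F; split=> //; exists t.
move=> [F dF <-]; elim: dF => {F} [F /one //|F F' irrF /one sF _ sF'].
rewrite range_product => _ [g /sF Gg [h /sF' Gh <-]].
exact: generated_groupM.
Qed.

Lemma mul_set_l S S' g : S g -> S' 1%g -> mul_set S S' g.
Proof. by move=> Sg S'1; exists g => //; exists 1%g => //; rewrite mulg1. Qed.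

Lemma mul_set_r S S' g : S 1%g -> S' g -> mul_set S S' g.
Proof. by move=> S1 S'g; exists 1%g => //; exists g => //; rewrite mul1g. Qed.

Lemma inv_set1 S : S 1%g -> inv_set S 1%g.
Proof. by move=> S1; exists 1%g => //; rewrite invg1. Qed.

End GroupsOfFamilies.

(** * Covering orbits uniformly *)

Section Exhaustion.
Context {k : closedFieldType} {X : fspace k}.
Context (irrX : irreducible_variety X) (I : aut_family X -> Prop).
Context (I_nonempty : exists F : aut_family X, I F).
Context (I_unital_algebraic : forall F : aut_family X, I F -> unital F /\ algebraic F).
Implicit Types (F H K : aut_family X) (g h : aut X) (S : set (aut X)).
Implicit Types (C : set X) (x y : X).

Local Notation G := (generated_group I).
Local Notation dset := (derived_set I).

Let pX : prevariety X := irrX.1.1.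
Let rX : regular_ring X := prevariety_regular_ring pX.
Let rXX : regular_ring (prod_space X X) := prod_regular_ring rX rX.

Let rT F : regular_ring (param F) := prevariety_regular_ring (param_irreducible F).1.1.

Let noethX : noetherian_on [set: X].
Proof. by have [[x0 _] _] := irrX.2; exact: prevariety_noetherian x0 pX. Qed.

Let pXX : prevariety (prod_space X X).
Proof. by have [[x0 _] _] := irrX.2; exact: prevariety_prod. Qed.

Let noethXX : noetherian_on [set: prod_space X X].
Proof. by have [[x0 _] _] := irrX.2; exact: (@prevariety_noetherian _ (prod_space X X) (x0, x0)). Qed.

(** Containing [1] makes these sets directed, since a product then includes both factors. *)
Lemma generated_group_cover g : G g -> exists S, [/\ dset S, S 1%g & S g].
Proof.
move: g; apply: generated_group_ind => [|g h|g|F IF g Fg].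
- have [F IF] := I_nonempty; have [F1 _] := I_unital_algebraic IF.
  by exists (range F); split=> //; exact: derived_set_family.
- move=> [S [dS S1 Sg]] [S' [dS' S'1 S'h]]; exists (mul_set S S').
  by split; [exact: derived_setM|exact: mul_set_l|exists g => //; exists h].
- move=> [S [dS S1 Sg]]; exists (inv_set S).
  by split; [exact: derived_setV|exact: inv_set1|exists g].
- have [F1 _] := I_unital_algebraic IF.
  by exists (range F); split=> //; exact: derived_set_family.
Qed.

(* Satisfied by the products of families of [I] without inverses; that
   inverses of algebraic families are algebraic is not proved here. *)
Definition positive F : Prop := [/\ unital F, algebraic F & dset (range F)].

Lemma positive_family F : I F -> positive F.
Proof.
move=> IF; have [F1 aF] := I_unital_algebraic IF.
by split=> //; exact: derived_set_family.
Qed.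

Lemma positiveM F H : positive F -> positive H -> exists2 K, positive K &
  range K = mul_set (range F) (range H).
Proof.
move=> [F1 /regular_map_onT aF dF] [H1 /regular_map_onT aH dH].
have irr := irreducible_variety_prod (param_irreducible F) (param_irreducible H).
exists (product_family irr); last exact: range_product.
split; [by rewrite /unital range_product; exact: mul_set_l| |
  by rewrite range_product; exact: derived_setM].
have rFH := prod_regular_ring (rT F) (rT H); have rFHX := prod_regular_ring rFH rX.
apply/regular_map_onT.
have rfst := iffRL (regular_map_onT _) (regular_map_fst rFH rX).
have rsnd := iffRL (regular_map_onT _) (regular_map_snd rFH rX).
have rF := iffRL (regular_map_onT _) (regular_map_fst (rT F) (rT H)).
have rH := iffRL (regular_map_onT _) (regular_map_snd (rT F) (rT H)).
(* The map [r5] sends [((t, s), x)] to [(t, H s x)]; the action of [F] is applied last. *)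
have r1 := regular_map_on_comp rfst rF (fun _ _ => Logic.I).
have r2 := regular_map_on_comp rfst rH (fun _ _ => Logic.I).
have r3 := regular_map_on_pair rFHX r2 rsnd.
have r4 := regular_map_on_comp r3 aH (fun _ _ => Logic.I).
have r5 := regular_map_on_pair rFHX r1 r4.
exact: regular_map_on_comp r5 aF (fun _ _ => Logic.I).
Qed.

Definition positive_elt g : Prop := exists2 F, positive F & range F g.

Lemma positive_elt_common g h : positive_elt g -> positive_elt h ->
  exists F, [/\ positive F, range F g & range F h].
Proof.
move=> [F pF Fg] [H pH Hh]; have [K pK rK] := positiveM pF pH.
have [F1 _ _] := pF; have [H1 _ _] := pH.
by exists K; rewrite rK; split=> //; [exact: mul_set_l|exact: mul_set_r].
Qed.

Lemma positive_eltM g h : positive_elt g -> positive_elt h -> positive_elt (g * h)%g.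
Proof.
move=> [F pF Fg] [H pH Hh]; have [K pK rK] := positiveM pF pH.
by exists K => //; rewrite rK; exists g => //; exists h.
Qed.

Lemma positive_orbit_continuous F x : positive F -> continuous (fun t : param F => F t x).
Proof.
move=> [_ /regular_map_onT aF _]; apply/continuous_onT.
have r1 := regular_map_pair (rT F) (@regular_map_id _ (param F))
  (regular_map_cst x (rT F)).
by have [] := regular_map_on_comp (iffRL (regular_map_onT _) r1) aF (fun _ _ => Logic.I).
Qed.

(* An inclusion [f Z `<=` Z] is an equality, by noetherianity; so it
   is inherited by inverses. *)
Lemma generated_group_stable (T : topologicalType) (a : aut X -> T -> T) (Z : set T) :
  noetherian_on [set: T] -> closed Z -> a 1%g =1 id ->
  (forall g h, a (g * h)%g =1 a g \o a h) -> (forall g, continuous (a g)) ->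
  (forall F f, I F -> range F f -> a f @` Z `<=` Z) ->
  forall g, G g -> a g @` Z `<=` Z.
Proof.
(* Proving stability under [g] and its inverse together makes the inversion step of the induction a
   mere swap. *)
move=> nT cZ a1 aM ca aI g Gg; suff [] : a g @` Z `<=` Z /\ a (g^-1)%g @` Z `<=` Z by [].
move: g Gg; apply: generated_group_ind => [|g h [gZ gVZ] [hZ hVZ]|g [gZ gVZ]|F IF f Ff].
- by rewrite invg1; split=> _ [z Zz <-]; rewrite a1.
- split=> _ [z Zz <-]; rewrite ?invgM aM /=.
    by apply: gZ; exists (a h z) => //; apply: hZ; exists z.
  by apply: hVZ; exists (a (g^-1)%g z) => //; apply: gVZ; exists z.
- by rewrite /= invgK.
- have fZ := aI F f IF Ff; split=> //.
  apply: (noetherian_stable nT cZ (ca _) _ _ fZ) => z.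
    by have := aM (f^-1)%g f z; rewrite mulVg a1.
  by have := aM f (f^-1)%g z; rewrite mulgV a1.
Qed.

Definition positive_orbit x : set X := [set g x | g in positive_elt].

(** Left multiplication by a member of [I] preserves the positive orbit, hence its closure;
    [generated_group_stable] extends this to inverses. *)
Lemma closure_positive_orbit x g : G g -> closure (positive_orbit x) (g x).
Proof.
move=> Gg; have st := @generated_group_stable X (fun g : aut X => g)
  (closure (positive_orbit x)) noethX (@closed_closure _ _) (fun=> erefl)
  (fun _ _ _ => erefl) aut_continuous.
apply: st Gg _ _ => [F f IF Ff|]; last first.
  exists x => //; apply: subset_closure; exists 1%g => //.
  have [F IF] := I_nonempty; have [F1 _ _] := positive_family IF.
  by exists F => //; exact: positive_family.
move=> _ [y cly <-].
have cf : continuous_on setT f by apply/continuous_onT; exact: aut_continuous.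
have := continuous_on_image cf (@subsetT _ _) Logic.I cly.
apply: closureS => _ [_ [h ph <-] <-]; exists (f * h)%g => //.
by apply: positive_eltM => //; exists F => //; exact: positive_family.
Qed.

(** Two positive elements lie in one positive family, whose orbit map has an irreducible image;
    density of the positive orbit does the rest. *)
Lemma orbit_irreducible (A B : set X) x : closed A -> closed B ->
  (forall g, G g -> A (g x) \/ B (g x)) ->
  (forall g, G g -> A (g x)) \/ (forall g, G g -> B (g x)).
Proof.
move=> cA cB AB.
suff [MA|MB] : positive_orbit x `<=` A \/ positive_orbit x `<=` B.
- left=> g /(@closure_positive_orbit x) clg.
  by apply: cA; exact: closureS MA _ clg.
- right=> g /(@closure_positive_orbit x) clg.
  by apply: cB; exact: closureS MB _ clg.
apply: contrapT => /not_orP[].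
move=> /existsNP[_ /not_implyP[[g pg <-] nA]].
move=> /existsNP[_ /not_implyP[[h ph <-] nB]].
have [F [pF [t _ Ft] [s _ Fs]]] := positive_elt_common pg ph.
have irrF := irreducible_set_image
  (iffRL (continuous_onT _) (@positive_orbit_continuous F x pF))
  (irreducible_setT (param_irreducible F).2).
have [_ [t' _ <-]|FA|FB] := irrF.2 A B cA cB.
- apply: AB; have [_ _ /derived_set_sub] := pF; apply; by exists t'.
- by apply: nA; rewrite -Ft; apply: FA; exists t.
- by apply: nB; rewrite -Fs; apply: FB; exists s.
Qed.

Definition invariant C : Prop := forall g, G g -> forall x, C x -> C (g x).

(** One [S] serves all orbits that meet [C]. It contains [1] so that the sets of two pieces can be
    multiplied into one for their union. *)
Definition uniformly_covered C : Prop := exists S, [/\ dset S, S 1%g &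
  forall x g, C x -> G g -> exists2 s, S s & s x = g x].

Lemma uniformly_coveredU C C' : uniformly_covered C -> uniformly_covered C' ->
  uniformly_covered (C `|` C').
Proof.
move=> [S [dS S1 SC]] [S' [dS' S'1 S'C]]; exists (mul_set S S').
split; [exact: derived_setM|exact: mul_set_l|] => x g [Cx|C'x] Gg.
  by have [s Ss <-] := SC x g Cx Gg; exists s => //; exact: mul_set_l.
by have [s Ss <-] := S'C x g C'x Gg; exists s => //; exact: mul_set_r.
Qed.

(** * Orbits over an irreducible invariant closed set *)

Section GenericOrbits.
Context (C : set X) (cC : closed C) (invC : invariant C).
Context (irrC : irreducible_set C).

Let graph F : set (prod_space X X) := [set z | C z.1 /\ exists t, z.2 = F t z.1].

Let graph_map F (z : prod_space (param F) X) : prod_space X X := (z.2, F z.1 z.2).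

Let graph_dom F : set (prod_space (param F) X) := [set z | setT z.1 /\ C z.2].

Let graph_map_regular F : positive F -> regular_map (@graph_map F).
Proof.
move=> [_ aF _]; apply: regular_map_pair => //; last exact: regular_map_snd.
exact: prod_regular_ring.
Qed.

Let graphE F : graph F = (@graph_map F) @` (@graph_dom F).
Proof.
apply/seteqP; split=> [[x y] [/= Cx [t ->]]|_ [[t x] [/= _ Cx] <-]].
  by exists (t, x).
by split=> //; exists t.
Qed.

Let irr_dom F : irreducible_set (@graph_dom F).
Proof.
apply: irreducible_set_prod => //.
exact: irreducible_setT (param_irreducible F).2.
Qed.

Let irr_graph F : positive F -> irreducible_set (graph F).
Proof.
move=> pF; rewrite graphE; apply: irreducible_set_image => //.
apply: (@continuous_onS _ _ _ setT) => //; apply/continuous_onT.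
by case: (graph_map_regular pF).
Qed.

Let subset_graphM F H K : unital F -> unital H ->
  range K = mul_set (range F) (range H) ->
  graph F `<=` graph K /\ graph H `<=` graph K.
Proof.
move=> F1 H1 rK; split=> -[x y] [/= Cx [t ->]].
  have [s _ Ks] : range K (F t) by rewrite rK; apply: mul_set_l => //; exists t.
  by split=> //; exists s; rewrite /= Ks.
have [s _ Ks] : range K (H t) by rewrite rK; apply: mul_set_r => //; exists t.
by split=> //; exists s; rewrite /= Ks.
Qed.

Lemma greatest_graph : exists2 F, positive F & forall H, positive H ->
  closure (graph H) `<=` closure (graph F).
Proof.
pose P := [set Z | exists2 F, positive F & Z = closure (graph F)].
have [||_ [F pF ->] Fmax] := @irreducible_acc_max _ P (prevariety_irreducible_acc pXX).
- move=> _ [F pF ->]; split; first exact: closed_closure.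
  exact: irreducible_set_closure (irr_graph pF).
- by have [F IF] := I_nonempty; exists (closure (graph F)), F => //; exact: positive_family.
exists F => // H pH; have [K pK rK] := positiveM pF pH.
have [F1 _ _] := pF; have [H1 _ _] := pH.
have [FK HK] := subset_graphM F1 H1 rK.
apply: subset_trans (closureS HK) _; apply: Fmax; first by exists K.
exact: closureS.
Qed.

Let second_act g (z : prod_space X X) : prod_space X X := (z.1, g z.2).

Let second_act_continuous g : continuous (second_act g).
Proof.
have rg := regular_map_on_comp (iffRL (regular_map_onT _) (regular_map_snd rX rX))
  (iffRL (regular_map_onT _) (aut_fun_regular g)) (fun _ _ => Logic.I).
by have [] := regular_map_pair rXX (regular_map_fst rX rX)
  (iffLR (regular_map_onT _) rg).
Qed.

Lemma graph_closure F g x : positive F -> (forall H, positive H ->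
  closure (graph H) `<=` closure (graph F)) -> C x -> G g ->
  closure (graph F) (x, g x).
Proof.
move=> pF Fmax Cx Gg.
have st := @generated_group_stable (prod_space X X) second_act
  (closure (graph F)) noethXX (@closed_closure _ _).
apply: (st _ _ second_act_continuous _ g Gg) => [[z1 z2] //|h l [z1 z2] //|H f IH Hf|].
  (* Multiplying [F] on the left by the family of [f] gives a positive family, so its graph stays in
     the greatest closure. *)
  have [K pK rK] := positiveM (positive_family IH) pF.
  apply: subset_trans (Fmax K pK).
  move=> _ [z clz <-].
  have cf : continuous_on setT (second_act f) by apply/continuous_onT.
  have := continuous_on_image cf (@subsetT _ _) Logic.I clz.
  apply: closureS => _ [[z1 z2] [/= Cz [t ->]] <-]; split=> //.
  have [s _ Ks] : range K (f * F t)%g.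
    by rewrite rK; exists f => //; exists (F t) => //; exists t.
  by exists s; rewrite /= Ks.
exists (x, x) => //; apply: subset_closure; split=> //.
by have [[t _ Ft] _ _] := pF; exists t; rewrite /= Ft.
Qed.

Lemma generic_cover : exists (V : set X) S, [/\ open V, C `&` V !=set0, dset S, S 1%g &
  forall x g, C x -> G g -> V x -> V (g x) -> exists2 s, S s & s x = g x].
Proof.
have [F pF Fmax] := greatest_graph; have [F1 aF dF] := pF.
have cdom : closed (@graph_dom F).
  have [+ _] := regular_map_snd (rT F) rX.
  move/continuous_closedP => /(_ _ cC); congr closed.
  by apply/seteqP; split=> z //= [].
have pTX : prevariety (prod_space (param F) X).
  have [[x0 _] _] := irrX.2; have [[t0 _] _] := (param_irreducible F).2.
  exact: prevariety_prod (param_irreducible F).1.1 pX.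
have [U [oU + +]] := image_contains_open pTX pXX (graph_map_regular pF) cdom (@irr_dom F).
rewrite -graphE => -[[x0 _] [[/= Cx0 [t0 ->]] Ux0]] UF.
have act_cont g h : continuous (fun x => (g x, h x) : prod_space X X).
  by have [] := regular_map_pair rX (aut_fun_regular g) (aut_fun_regular h).
(* Instead of projecting [U], the parameter [t0] of one of its points is fixed: [V] is then the
   preimage of [U] under a continuous map. *)
exists [set x | U (x, F t0 x)], (mul_set (inv_set (range F)) (range F)); split.
- by move/continuousP: (act_cont 1%g (F t0)) => /(_ _ oU).
- by exists x0.
- by apply: derived_setM => //; exact: derived_setV.
- by apply: mul_set_l => //; exact: inv_set1.
move=> x g Cx Gg /= Vx Vgx.
have G1 h : range F h -> G h by move: h; exact: derived_set_sub.
have slice (y : X) : continuous (fun z : X => (y, z) : prod_space X X).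
  by have [] := regular_map_pair rX (regular_map_cst y rX) (@regular_map_id _ X).
have oslice y : open [set z | U (y, z)] by move/continuousP: (slice y) => /(_ _ oU).
(* The slice of [U] over [y] contains [F t0 y], a point of the orbit of [x], and so meets the dense
   positive orbit of [x]. *)
have meets y : C y -> U (y, F t0 y) -> forall h, G h -> h x = y ->
    exists2 m, positive_elt m & U (y, m x).
  move=> Cy Uy h Gh hx; have GFh : G (F t0 * h)%g.
    by apply: generated_groupM => //; apply: G1; exists t0.
  have := @closure_positive_orbit x _ GFh => /(_ [set z | U (y, z)]).
  case; first by apply: open_nbhs_nbhs; split=> //=; rewrite hx.
  by move=> _ [[m pm <-] Um]; exists m.
have [m pm Um] := meets x Cx Vx 1%g (generated_group1 (I := I)) erefl.
have [m' pm' Um'] := meets (g x) (invC Gg Cx) Vgx g Gg erefl.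
have [H [pH [t _ Ht] [s _ Hs]]] := positive_elt_common pm pm'.
have cH := @positive_orbit_continuous H x pH.
have [||||r [_ [Ur Ur']]] := irreducible_setI2
  (irreducible_setT (param_irreducible H).2)
  (U := [set r | U (x, H r x)]) (V := [set r | U (g x, H r x)]).
- by move/continuousP: cH => /(_ _ (oslice x)).
- by move/continuousP: cH => /(_ _ (oslice (g x))).
- by exists t; split=> //=; rewrite Ht.
- by exists s; split=> //=; rewrite Hs.
have GH : G (H r) by have [_ _ /derived_set_sub] := pH; apply; exists r.
have [_ [t1 /= Ht1]] : graph F (x, H r x).
  by apply: UF; split=> //; exact: graph_closure.
(* Over [g x] the same point is the image under [H r * g^-1], so it lies in the closed graph there
   too. *)
have [_ [t2 /= Ht2]] : graph F (g x, H r x).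
  apply: UF; split=> //.
  have := graph_closure pF Fmax (invC Gg Cx) (generated_groupM GH (generated_groupV Gg)).
  by rewrite autM autVK.
exists ((F t2)^-1 * F t1)%g; last by rewrite autM -Ht1 Ht2 autVK.
by exists (F t2)^-1%g; [exists (F t2) => //; exists t2|exists (F t1) => //; exists t1].
Qed.

(* By noetherianity the translates of [V] by some derived set [K] already cover
   [G V `&` C]. *)
Lemma uniformly_covered_off_proper : exists C', [/\ closed C', invariant C',
  C' `<=` C, ~ (C `<=` C') & uniformly_covered (C `\` C')].
Proof.
have [V [S [oV [x0 [Cx0 Vx0]] dS S1 SV]]] := generic_cover.
pose rest (K : set (aut X)) := [set x | C x /\ forall g, K g -> ~ V ((g^-1)%g x)].
have closed_rest (K : set (aut X)) : closed (rest K).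
  rewrite (_ : rest K = C `&` \bigcap_(g in K) ((g^-1)%g @^-1` ~` V)).
    apply: closedI => //; apply: closed_bigI => g _.
    by move/continuous_closedP: (@aut_continuous _ _ (g^-1)%g); apply; rewrite closedC.
  by apply/seteqP; split.
have [||_ [K [dK K1] ->] Kmin] := @noetherian_min _
  [set D | exists2 K : set (aut X), dset K /\ K 1%g & D = rest K] noethX.
- by move=> _ [K _ ->]; exact: closed_rest.
- have [F IF] := I_nonempty; exists (rest (range F)), (range F) => //.
  by split; [exact: derived_set_family|have [] := I_unital_algebraic IF].
(* Enlarging [K] by a set containing [g] cannot shrink the minimal [rest K], so no translate of [V]
   under [G] meets it; this makes it invariant. *)
have Kall x g : rest K x -> G g -> ~ V ((g^-1)%g x).
  move=> Kx /generated_group_cover[S' [dS' S'1 S'g]].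
  have [||_ nV] := Kmin (rest (mul_set K S')) _ _ x Kx.
  - by exists (mul_set K S') => //; split; [exact: derived_setM|exact: mul_set_l].
  - by move=> y [Cy nV]; split=> // h Kh; apply: nV; exact: mul_set_l.
  by apply: nV; exact: mul_set_r.
exists (rest K); split=> //.
- move=> g Gg x Kx; split=> [|h Kh]; first by apply: invC => //; case: Kx.
  have Gh : G h by exact: derived_set_sub dK _ Kh.
  have := Kall x ((g^-1) * h)%g Kx (generated_groupM (generated_groupV Gg) Gh).
  by rewrite invgM invgK.
- by move=> x [].
- by move=> /(_ x0 Cx0) [_ /(_ 1%g K1)]; rewrite invg1; apply.
(* [h^-1] moves [x] into [V], an element of [S] carries it on to [h'^-1 (g x)], again in [V], and
   [h'] leads to [g x]. *)
exists (mul_set (mul_set K S) (inv_set K)); split.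
- by apply: derived_setM; [exact: derived_setM|exact: derived_setV].
- by apply: mul_set_l; [exact: mul_set_l|exact: inv_set1].
have inKV x : (C `\` rest K) x -> exists2 h, K h & V ((h^-1)%g x).
  move=> [Cx nK]; apply: contrapT => noh; apply: nK; split=> // h Kh Vh.
  by apply: noh; exists h.
move=> x g Dx Gg; have [h Kh Vh] := inKV x Dx.
have GK l : K l -> G l by exact: derived_set_sub dK l.
have Cx : C x by case: Dx.
have [h' Kh' Vh'] : exists2 h', K h' & V ((h'^-1)%g (g x)).
  apply: contrapT => noh.
  have Kgx : rest K (g x).
    by split=> [|l Kl Vl]; [exact: invC|apply: noh; exists l].
  have := Kall (g x) (g * h)%g Kgx (generated_groupM Gg (GK _ Kh)).
  by rewrite invgM !autM autVK.
have Gm : G ((h'^-1) * (g * h))%g := generated_groupM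
  (generated_groupV (GK _ Kh')) (generated_groupM Gg (GK _ Kh)).
have [|s Ss sE] := SV _ _ (invC (generated_groupV (GK _ Kh)) Cx) Gm Vh.
  by rewrite !autM autKV.
exists (h' * s * h^-1)%g; last by rewrite !autM sE !autM !autKV.
exists (h' * s)%g; first by exists h' => //; exists s.
by exists (h^-1)%g => //; exists h.
Qed.

End GenericOrbits.

Lemma closed_invariant_uniformly_covered C :
  closed C -> invariant C -> uniformly_covered C.
Proof.
move=> cC invC; apply: contrapT => nC.
have [||D [cD invD nD] Dmin] := @noetherian_min _
  [set D | [/\ closed D, invariant D & ~ uniformly_covered D]] noethX.
- by move=> D [].
- by exists C.
have covered D' : closed D' -> invariant D' -> D' `<=` D -> ~ (D `<=` D') ->
    uniformly_covered D'.
  by move=> cD' invD' D'D nDD'; apply: contrapT => nD'; apply: nDD'; exact: Dmin.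
have uniformly_coveredS A B : A `<=` B -> uniformly_covered B -> uniformly_covered A.
  by move=> AB [S [dS S1 SB]]; exists S; split=> // x g /AB; exact: SB.
have irrD : irreducible_set D.
  split.
    apply: contrapT => D0; apply: nD; have [F IF] := I_nonempty.
    have [F1 _ dF] := positive_family IF; exists (range F); split=> // x g Dx.
    by exfalso; apply: D0; exists x.
  move=> A B cA cB DAB; apply: contrapT => /not_orP[nA nB]; apply: nD.
  (* The largest invariant subset of [D] contained in [A]; being closed and proper, it is covered by
     minimality of [D]. *)
  pose core A := [set x | D x /\ forall g, G g -> A (g x)].
  have core_covered A' : closed A' -> ~ (D `<=` A') -> uniformly_covered (core A').
    move=> cA' nA'; apply: covered => [|g Gg x [Dx Ax]|x []//|].
    - rewrite (_ : core A' = D `&` \bigcap_(g in G) ((g : aut X) @^-1` A')).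
        apply: closedI => //; apply: closed_bigI => g _.
        by move/continuous_closedP: (@aut_continuous _ _ g); exact.
      by apply/seteqP; split.
    - split; first exact: invD.
      by move=> h Gh; exact: (Ax (h * g)%g (generated_groupM Gh Gg)).
    - move=> DA; apply: nA' => x /DA[_ /(_ 1%g (generated_group1 (I := I)))]; exact.
  apply: uniformly_coveredS (uniformly_coveredU (core_covered A cA nA) (core_covered B cB nB)).
  move=> x Dx; have [|GA|GB] := @orbit_irreducible A B x cA cB.
  - by move=> g Gg; apply: DAB; exact: invD.
  - by left.
  - by right.
have [D' [cD' invD' D'D nDD' cov]] := uniformly_covered_off_proper cD invD irrD.
apply: nD; apply: uniformly_coveredS (uniformly_coveredU (covered D' cD' invD' D'D nDD') cov).
by move=> x Dx; have [|] := pselect (D' x); [left|right].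
Qed.

End Exhaustion.

Theorem theorem1 (k : closedFieldType) (X : fspace k)
    (irrX : irreducible_variety X)
    (I : aut_family X -> Prop)
    (I_nonempty : exists F : aut_family X, I F)
    (I_unital_algebraic : forall F : aut_family X, I F -> unital F /\ algebraic F)
    (G : set (aut X)) (G_generated : G = generated_group I)
    (Y : set X) (Y_locally_closed : locally_closed Y)
    (Y_invariant : aut_invariant G Y) :
  exists F : aut_family X, derived I F /\ exhaustive F G Y.
Proof.
have [|S [[F dF rF] _ FX]] := closed_invariant_uniformly_covered irrX I_nonempty
  I_unital_algebraic (@closedT X); first by [].
exists F; split=> // y _; rewrite G_generated; apply/seteqP; split.
  move=> _ [g Gg <-]; have [s Ss <-] := FX y g Logic.I Gg.
  by move: Ss; rewrite -rF => -[t _ <-]; exists t.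
move=> _ [t _ <-]; exists (F t) => //.
by apply: (@derived_set_sub _ _ I (range F)); [exists F|exists t].
Qed.
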